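(* Let $v=\operatorname{sgrad}H$ be an integrable, in the Bott sense, nonresonance Hamiltonian system on the isoenergetic surface $Q^3$, and let $\mathcal P$ be the partitioning of the manifold $Q^3$ into Liouville tori, critical circles of the additional Bott integral $f$ and rings of the type $S^1\times(0,1)$. Then the cohomology groups $H^*_{\mathcal P}(Q^3)$ are topological invariants of the system $v$, i.e., to topologically equivalent systems there correspond isomorphic groups.
   Context: Hamiltonian systems. Let $v=\operatorname{sgrad}H$ be a Hamiltonian system on a symplectic four-dimensional manifold $(M^4,\omega)$, let $h$ be a regular value of $H$, and let $Q^3\subset M^4$ be the isoenergetic surface given by $H(x)=h$, assumed to be a closed manifold; the restriction of the system to $Q^3$ is also denoted by $v$. The system is integrable if, besides $H$, there is an additional smooth first integral $f$ in involution with $H$ and independent of $H$ almost everywhere. It is integrable in the Bott sense if among Bott functions on $Q^3$ there is an additional first integral $f$ of $v$; a function is a Bott function if all its critical points are organized into nondegenerate critical submanifolds, meaning that the restriction of the function to every normal plane to such a submanifold has a nondegenerate Morse singularity at the point of intersection with the submanifold. Compact connected nonsingular common level surfaces of $H$ and $f$ are the Liouville tori $T^2$. The critical fibers (connected components of critical level surfaces of $f$ on $Q^3$) are of the following types: (1) the torus $T^2$; (2) the Klein bottle $K^2$; (3) the circle $S^1$; (4) a piecewise smooth two-dimensional polyhedron with a singularity of the type of a ''fourfold line'' (a transversal intersection of two planes). In cases (1)–(3) the critical fiber consists entirely of critical points of $f$ at which a maximum or a minimum is attained; in case (4) the critical points of $f$ are ''saddle'' (hyperbolic) critical circles. The Hamiltonian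 $H$ (and the system) is nonresonance on $Q^3$ if the set of Liouville tori with irrational windings is everywhere dense in $Q^3$. The partitioning $\mathcal P$. The surface $Q^3$ is considered as the set of Liouville tori, circles $S^1$ (maximal, minimal and saddle-type critical circles of $f$) and rings of the type $S^1\times(0,1)$, which are obtained from a hyperbolic critical fiber of type (4) by removing the hyperbolic critical circles of $f$. This partitioning of $Q^3$ is denoted by $\mathcal P$. The cohomology $H^*_{\mathcal P}(Q^3)$. Let $S(Q^3)$ be the Lie algebra of smooth vector fields on $Q^3$, and let $\overline S(Q^3)$ be its Lie subalgebra consisting of the smooth vector fields on $Q^3$ tangent to the manifolds of the partitioning $\mathcal P$. The algebra $C^\infty(Q^3)$ is a module over $\overline S(Q^3)$ with respect to the product $X\cdot g=Xg$, $X\in\overline S(Q^3)$, $g\in C^\infty(Q^3)$. A $k$-dimensional cochain of $\overline S(Q^3)$ with coefficients in $C^\infty(Q^3)$ is an element of the space $A^k(\overline S(Q^3))$, i.e. a skew-symmetric $k$-linear functional on $\overline S(Q^3)$ with values in $C^\infty(Q^3)$. The differential $d^k:A^k(\overline S(Q^3))\to A^{k+1}(\overline S(Q^3))$ is $$d^k\alpha(X_1,\dots,X_{k+1})=\sum_{i=1}^{k+1}(-1)^{i-1}X_i\,\alpha(X_1,\dots,\widehat X_i,\dots,X_{k+1})+\sum_{i<j}(-1)^{i+j}\alpha([X_i,X_j],X_1,\dots,\widehat X_i,\dots,\widehat X_j,\dots,X_{k+1}).$$ $H^*_{\mathcal P}(Q^3)$ denotes the cohomology of the cochain complex $(A^*(\overline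 S(Q^3)),d^* )$. Topological equivalence. Two integrable, in the Bott sense, nonresonance Hamiltonian systems $v_1,v_2$ on the oriented manifolds $Q_1^3,Q_2^3$ are topologically equivalent if there exists an orientation preserving diffeomorphism $g:Q_1^3\to Q_2^3$ which transforms the Liouville tori of the system $v_1$ to those of the system $v_2$ (critical tori are included in the number of Liouville tori), and the isolated critical circles to the isolated critical circles with the same orientation, the orientation of the critical circles being the one given by the fields $v_1$, $v_2$. *)

(* Defs.v *)
From HB Require Import structures.
From mathcomp Require Import all_boot all_order all_fingroup all_algebra.
From mathcomp Require Import all_classical all_reals all_analysis.
From mathcomp Require Import ring lra.

Set Implicit Arguments.
Unset Strict Implicit.
Unset Printing Implicit Defensive.

Import Order.TTheory GRing.Theory Num.Theory.
Import numFieldNormedType.Exports.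

Local Open Scope classical_set_scope.
Local Open Scope ring_scope.

Section ChevalleyEilenberg.
Variables (R : comNzRingType) (L C : lmodType R).
Variables (br : L -> L -> L) (act : L -> {linear C -> C}).

Definition multilinear k (a : ('I_k -> L) -> C) : Prop :=
  forall (X : 'I_k -> L) (i : 'I_k) (c : R) (u v : L),
    a [eta X with i |-> c *: u + v]
    = c *: a [eta X with i |-> u] + a [eta X with i |-> v].

Definition skew k (a : ('I_k -> L) -> C) : Prop :=
  forall (X : 'I_k -> L) (s : 'S_k), a (X \o s) = (-1) ^+ s *: a X.

Definition cochain k (a : ('I_k -> L) -> C) : Prop := multilinear a /\ skew a.

(* The arguments ([X_i, X_j], X_0, .., ^X_i, .., ^X_j, .., X_k), for i < j:
   m |-> bump j (bump i m) enumerates in order the indices other than i, j. *)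
Definition bracket_args k (X : 'I_k.+1 -> L) (i j : 'I_k.+1) : 'I_k -> L :=
  fun m => if m == 0 :> nat then br (X i) (X j)
           else X (inord (bump j (bump i m.-1))).

(* Indices start at 0, whence the sign (-1)^i in the first sum; the parity of
   i + j is the same with both numberings. *)
Definition ce_diff k (a : ('I_k -> L) -> C) : ('I_k.+1 -> L) -> C :=
  fun X =>
    \sum_(i < k.+1) (-1) ^+ i *: act (X i) (a (X \o lift i))
    + \sum_(i < k.+1) \sum_(j < k.+1 | (i < j)%N)
        (-1) ^+ (i + j) *: a (bracket_args X i j).

Lemma cochainB k (a b : ('I_k -> L) -> C) :
  cochain a -> cochain b -> cochain (a - b).
Proof.
move=> [la sa] [lb sb]; split=> [X i c u v|X s].
  by rewrite !fctE la lb scalerBr opprD addrACA.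
by rewrite !fctE sa sb scalerBr.
Qed.

Lemma cochain0 k : cochain (0 : ('I_k -> L) -> C).
Proof.
by split=> [X i c u v|X s]; rewrite /GRing.zero /= scaler0 ?addr0.
Qed.

Lemma ce_diffB k (a b : ('I_k -> L) -> C) :
  ce_diff (a - b) = ce_diff a - ce_diff b.
Proof.
apply/funext => X; rewrite /ce_diff !fctE opprD addrACA -!sumrB.
congr (_ + _); apply: eq_bigr => i _; first by rewrite linearB scalerBr.
by rewrite -sumrB; apply: eq_bigr => j _; rewrite scalerBr.
Qed.

Lemma ce_diff0 k : ce_diff (0 : ('I_k -> L) -> C) = 0.
Proof. by rewrite -[X in ce_diff X](subrr 0) ce_diffB subrr. Qed.

Definition cocycle k : {pred ('I_k -> L) -> C} :=
  fun a => `[< cochain a /\ ce_diff a = 0 >].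

Lemma cocycle_zmod_closed k : zmod_closed (@cocycle k).
Proof.
split=> [|a b /asboolP[ca za] /asboolP[cb zb]]; apply/asboolP.
  by split; [exact: cochain0|exact: ce_diff0].
by split; [exact: cochainB|rewrite ce_diffB za zb subrr].
Qed.

HB.instance Definition _ k :=
  GRing.isZmodClosed.Build _ (@cocycle k) (@cocycle_zmod_closed k).

Record cocycles (k : nat) :=
  Cocycle { cocycle_val : ('I_k -> L) -> C; _ : cocycle_val \in @cocycle k }.

HB.instance Definition _ k := [isSub for @cocycle_val k].
HB.instance Definition _ k := [Choice of cocycles k by <:].
HB.instance Definition _ k :=
  [SubChoice_isSubZmodule of cocycles k by <:].

Definition exact_cochain k : (('I_k -> L) -> C) -> Prop :=
  match k with
  | 0 => fun a => a = 0
  | k'.+1 => fun a => exists2 b : ('I_k' -> L) -> C, cochain b & a = ce_diff b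
  end.

Definition coboundary k : {pred cocycles k} :=
  fun z => `[< exact_cochain (val z) >].

Lemma coboundary_zmod_closed k : zmod_closed (@coboundary k).
Proof.
split=> [|y z /asboolP ey /asboolP ez]; apply/asboolP.
  by case: k => [|k] //=; exists 0; [exact: cochain0|rewrite ce_diff0].
case: k y z ey ez => [|k] y z /=; first by move=> -> ->; rewrite subrr.
move=> [b cb ->] [c cc ->]; exists (b - c); first exact: cochainB.
by rewrite ce_diffB.
Qed.

HB.instance Definition _ k :=
  GRing.isZmodClosed.Build _ (@coboundary k) (@coboundary_zmod_closed k).

Definition ce_cohomology (k : nat) : zmodType :=
  Quotient.quot (@coboundary k).

End ChevalleyEilenberg.

Section Euclidean.
Variable R : realType.

Fixpoint Ck n (k : nat) (U : set 'rV[R]_n) (F : 'rV[R]_n -> R) : Prop :=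
  (forall x, U x -> {for x, continuous F}) /\
  if k is k'.+1 then
    forall i : 'I_n, (forall x, U x -> derivable F x (delta_mx 0 i)) /\
      Ck k' U (fun x => 'D_(delta_mx 0 i) F x)
  else True.

Definition Cinfty_on n (U : set 'rV[R]_n) (F : 'rV[R]_n -> R) : Prop :=
  forall k, Ck k U F.

Definition Cinfty_at n (y : 'rV[R]_n) (F : 'rV[R]_n -> R) : Prop :=
  exists U : set 'rV[R]_n, [/\ open U, U y & Cinfty_on U F].

(* Sets of Lebesgue measure zero. Balls of the sup norm are cubes, of volume
   (2r)^n. *)
Definition null_set n (A : set 'rV[R]_n) : Prop :=
  forall e : R, 0 < e -> exists (c : nat -> 'rV[R]_n) (r : nat -> R),
    [/\ forall i, 0 <= r i,
        A `<=` \bigcup_i ball (c i) (r i)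
      & forall m, \sum_(i < m) (2 * r i) ^+ n <= e].

End Euclidean.

(* A smooth structure is given by its algebra of smooth functions (as in
   Bredon or Nestruev); a manifold is such a space locally diffeomorphic to
   R^n. Level sets then inherit a structure without choosing charts. *)

Record dspace (R : realType) := DSpace {
  points :> topologicalType;
  smooth : set (points -> R);
  smooth_cst : forall c : R, smooth (cst c);
  smoothD : forall f g, smooth f -> smooth g -> smooth (f + g);
  smoothM : forall f g, smooth f -> smooth g -> smooth (f * g) }.

Section SmoothFunctions.
Variables (R : realType) (X : dspace R).

Definition smooth_pred : {pred X -> R} := fun f => `[< smooth f >].

Lemma smooth_subring_closed : subring_closed smooth_pred.
Proof.
split=> [|f g /asboolP sf /asboolP sg|f g /asboolP sf /asboolP sg].
- exact/asboolP/smooth_cst.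
- apply/asboolP; rewrite -mulN1r; apply: smoothD => //.
  by apply: smoothM => //; exact: (smooth_cst X (-1)).
- exact/asboolP/smoothM.
Qed.

Lemma smooth_submod_closed : submod_closed smooth_pred.
Proof.
split=> [|c f g /asboolP sf /asboolP sg]; apply/asboolP.
  exact: (smooth_cst X 0).
apply: smoothD => //.
by apply: (smoothM (f := cst c)) => //; exact: smooth_cst.
Qed.

HB.instance Definition _ :=
  GRing.isSubringClosed.Build _ smooth_pred smooth_subring_closed.
HB.instance Definition _ :=
  GRing.isSubmodClosed.Build R _ smooth_pred smooth_submod_closed.

Record Cinf := MkCinf { cval :> X -> R; _ : cval \in smooth_pred }.

HB.instance Definition _ := [isSub for cval].
HB.instance Definition _ := [Choice of Cinf by <:].
HB.instance Definition _ := 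
  GRing.SubChoice_isSubComPzRing.Build _ _ Cinf smooth_subring_closed.
HB.instance Definition _ := [SubZmodule_isSubLmodule of Cinf by <:].

(* The tangent space at p: point derivations. *)
Definition tangent_vector (p : X) (w : Cinf -> R) : Prop :=
  (forall (c : R) f g, w (c *: f + g) = c * w f + w g) /\
  (forall f g : Cinf, w (f * g) = w f * g p + f p * w g).

Definition critical (f : Cinf) (p : X) : Prop :=
  forall w, tangent_vector p w -> w f = 0.

(* Vector fields are derivations of the algebra of smooth functions. *)
Definition derivation : {pred Cinf -> Cinf} := fun D =>
  `[< (forall (c : R) f g, D (c *: f + g) = c *: D f + D g) /\
      (forall f g : Cinf, D (f * g) = D f * g + f * D g) >].

Lemma derivation_submod_closed : submod_closed derivation.
Proof.
split=> [|c D E /asboolP[lD mD] /asboolP[lE mE]]; apply/asboolP.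
  by split=> *; rewrite /GRing.zero /= ?scaler0 ?mul0r ?mulr0 ?addr0.
split=> [d f g|f g]; rewrite !fctE.
  by rewrite lD lE !scalerDr !scalerA [d * c]mulrC addrACA.
rewrite mD mE; apply/val_inj/funext => p /=.
rewrite !fctE /= /GRing.scale /=; ring.
Qed.

HB.instance Definition _ :=
  GRing.isSubmodClosed.Build R _ derivation derivation_submod_closed.

Record vfield := MkVfield {
  vfield_fun :> Cinf -> Cinf; _ : vfield_fun \in derivation }.

HB.instance Definition _ := [isSub for vfield_fun].
HB.instance Definition _ := [Choice of vfield by <:].
HB.instance Definition _ := [SubChoice_isSubLmodule of vfield by <:].

Lemma vfieldP (D : vfield) :
  (forall (c : R) f g, D (c *: f + g) = c *: D f + D g) /\
  (forall f g : Cinf, D (f * g) = D f * g + f * D g).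
Proof. by case: D => D /= /asboolP. Qed.

Lemma bracket_subproof (D E : vfield) :
  (fun f => D (E f) - E (D f)) \in derivation.
Proof.
have [lD mD] := vfieldP D; have [lE mE] := vfieldP E.
have aD f g : D (f + g) = D f + D g.
  by rewrite -[f in LHS]scale1r lD scale1r.
have aE f g : E (f + g) = E f + E g.
  by rewrite -[f in LHS]scale1r lE scale1r.
apply/asboolP; split=> [c f g|f g].
  by rewrite lE lD lD lE scalerBr opprD addrACA.
rewrite mE mD aD aE !mD !mE.
by apply/val_inj/funext => p /=; rewrite !fctE /=; ring.
Qed.

Definition bracket (D E : vfield) : vfield := MkVfield (bracket_subproof D E).

Lemma fscale_subproof (f : Cinf) (D : vfield) :
  (fun g => f * D g) \in derivation.
Proof.
have [lD mD] := vfieldP D; apply/asboolP; split=> [c g h|g h].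
  rewrite lD; apply/val_inj/funext => p /=.
  by rewrite !fctE /= /GRing.scale /=; ring.
by rewrite mD; apply/val_inj/funext => p /=; rewrite !fctE /=; ring.
Qed.

Definition fscale (f : Cinf) (D : vfield) : vfield :=
  MkVfield (fscale_subproof f D).

Definition lie_derivative (D : vfield) : Cinf -> Cinf := D.

Lemma lie_derivative_linear (D : vfield) : linear (lie_derivative D).
Proof. by move=> c f g; exact: (vfieldP D).1. Qed.

HB.instance Definition _ (D : vfield) :=
  GRing.isLinear.Build R Cinf Cinf _ (lie_derivative D)
    (lie_derivative_linear D).

Definition form k (w : ('I_k -> vfield) -> Cinf) : Prop :=
  cochain w /\
  forall (X : 'I_k -> vfield) (i : 'I_k) (f : Cinf) (D : vfield),
    w [eta X with i |-> fscale f D] = f * w [eta X with i |-> D].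

Definition closed_form k (w : ('I_k -> vfield) -> Cinf) : Prop :=
  ce_diff bracket lie_derivative w = 0.

Definition vpair (D E : vfield) : 'I_2 -> vfield :=
  fun i => if i == ord0 then D else E.

Definition symplectic (w : ('I_2 -> vfield) -> Cinf) : Prop :=
  [/\ form w, closed_form w
    & forall (p : X) (D : vfield), (forall E, w (vpair D E) p = 0) ->
        forall f, D f p = 0].

(* v = sgrad H, with the convention w(Y, sgrad H) = Y H. *)
Definition sgrad (w : ('I_2 -> vfield) -> Cinf) (H : Cinf) (v : vfield) : Prop :=
  forall Y, w (vpair Y v) = Y H.

(* A nowhere vanishing form of top degree n, representing an orientation. *)
Definition volume_form n (w : ('I_n -> vfield) -> Cinf) : Prop :=
  form w /\ forall p : X, exists Y, w Y p != 0.

(* A vector w at a point p of a submanifold L is tangent to L iff it factors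
   through restriction to L, i.e. kills the functions vanishing on L near p. *)
Definition tangent_to (L : set X) (D : vfield) : Prop :=
  forall p : X, L p ->
  forall f : Cinf, (\forall q \near p, L q -> f q = 0) -> D f p = 0.

Definition tangent_all (P : set (set X)) : {pred vfield} :=
  fun D => `[< forall L, P L -> tangent_to L D >].

Lemma tangent_all_submod_closed P : submod_closed (tangent_all P).
Proof.
split=> [|c D E /asboolP tD /asboolP tE]; apply/asboolP => L PL p Lp f fL.
  by [].
by rewrite /= !fctE /= (tD L PL p Lp f fL) (tE L PL p Lp f fL) scaler0 addr0.
Qed.

HB.instance Definition _ P :=
  GRing.isSubmodClosed.Build R _ (tangent_all P) (tangent_all_submod_closed P).

Record tfield (P : set (set X)) := MkTfield {
  tfield_val :> vfield; _ : tfield_val \in tangent_all P }.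

HB.instance Definition _ P := [isSub for @tfield_val P].
HB.instance Definition _ P := [Choice of tfield P by <:].
HB.instance Definition _ P := [SubChoice_isSubLmodule of tfield P by <:].

Lemma tbracket_subproof P (D E : tfield P) : bracket D E \in tangent_all P.
Proof.
case: D E => D /= /asboolP tD [E /= /asboolP tE].
apply/asboolP => L PL p Lp f fL /=; rewrite !fctE /=.
have aux (G : vfield) : tangent_to L G ->
    \forall q \near p, L q -> G f q = 0.
  move=> tG; have : \forall q \near p, nbhs q (fun r => L r -> f r = 0).
    exact: (nbhs_interior fL).
  by apply: filterS => q fq Lq; exact: (tG q Lq).
rewrite (tD L PL p Lp) ?(tE L PL p Lp) ?subrr //.
  exact/aux/tD.
exact/aux/tE.
Qed.

Definition tbracket P (D E : tfield P) : tfield P :=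
  MkTfield (tbracket_subproof D E).

Definition tlie_derivative P (D : tfield P) : {linear Cinf -> Cinf} :=
  lie_derivative D.

Definition HP (P : set (set X)) (k : nat) : zmodType :=
  ce_cohomology (@tbracket P) (@tlie_derivative P) k.

Record chart n := Chart {
  cdom : set X;
  coord : X -> 'rV[R]_n;
  param : 'rV[R]_n -> X }.

Definition locally_smooth (p : X) (F : X -> R) : Prop :=
  exists g : Cinf, \forall q \near p, F q = g q.

Definition is_chart n (c : chart n) : Prop :=
  [/\ open (cdom c) /\ open (coord c @` cdom c),
      forall p, cdom c p -> {for p, continuous (coord c)},
      forall p, cdom c p -> {for coord c p, continuous (param c)},
      forall p, cdom c p -> param c (coord c p) = p
    & forall p, cdom c p -> forall F : X -> R,
        locally_smooth p F <-> Cinfty_at (coord c p) (F \o param c)].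

Definition manifold n : Prop :=
  [/\ hausdorff_space X, @second_countable X,
      forall p : X, exists2 c : chart n, is_chart c & cdom c p
    & forall F : X -> R, (forall p, locally_smooth p F) -> smooth F].

Definition closed_manifold n : Prop := manifold n /\ compact [set: X].

(* m-dimensional torus R^m / Z^m smoothly embedded in X, with image L. *)
Definition torus_param m (T : 'rV[R]_m -> X) (L : set X) : Prop :=
  [/\ forall g : Cinf, Cinfty_on setT (g \o T),
      forall s u, u != 0 -> exists g : Cinf, 'D_u (g \o T) s != 0,
      range T = L
    & forall s t, T s = T t <-> forall i, s 0 i - t 0 i \is a Num.int].

Definition embedded_torus m (L : set X) : Prop :=
  exists T : 'rV[R]_m -> X, torus_param T L.

Definition null (n : nat) (A : set X) : Prop :=
  forall c : chart n, is_chart c -> null_set (coord c @` (cdom c `&` A)).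

(* The critical set of f near p is the submanifold on which the coordinates of
   index in N are constant; the slices on which the other coordinates are
   constant are transversal to it. *)
Definition slice_chart n (f : Cinf) (p : X) (c : chart n) (N : {set 'I_n}) :=
  [/\ is_chart c, cdom c p
    & forall q, cdom c q ->
        critical f q <-> forall i, i \in N -> coord c q 0 i = coord c p 0 i].

Definition nondegenerate n (f : Cinf) (p : X) (c : chart n) (N : {set 'I_n}) :=
  let F := f \o param c in
  let d i j :=
    'D_(delta_mx 0 i) (fun x => 'D_(delta_mx 0 j) F x) (coord c p) in
  \det (\matrix_(a < #|N|, b < #|N|) d (enum_val a) (enum_val b)) != 0.

Definition bott n (f : Cinf) : Prop :=
  forall p : X, critical f p ->
    (exists (c : chart n) N, slice_chart f p c N) /\
    (forall (c : chart n) N, slice_chart f p c N -> nondegenerate f p c N).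

End SmoothFunctions.

Section Subspace.
Variables (R : realType) (X : dspace R) (A : set X).

(* Local restrictions to A of smooth functions on X. *)
Definition sub_smooth : set (set_type A -> R) :=
  [set F | forall p : set_type A,
     exists g : Cinf X, \forall q \near p, F q = g (val q)].

Lemma restr_cst c : sub_smooth (cst c).
Proof.
move=> p; have sc : (cst c : X -> R) \in @smooth_pred R X.
  exact/asboolP/smooth_cst.
by exists (MkCinf sc); apply: filterE.
Qed.

Lemma sub_smoothD F G : sub_smooth F -> sub_smooth G -> sub_smooth (F + G).
Proof.
move=> sF sG p; have [f Ff] := sF p; have [g Gg] := sG p.
by exists (f + g); near=> q; rewrite /= !fctE (near Ff q) // (near Gg q).
Unshelve. all: by end_near. Qed.

Lemma sub_smoothM F G : sub_smooth F -> sub_smooth G -> sub_smooth (F * G).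
Proof.
move=> sF sG p; have [f Ff] := sF p; have [g Gg] := sG p.
by exists (f * g); near=> q; rewrite /= !fctE (near Ff q) // (near Gg q).
Unshelve. all: by end_near. Qed.

Definition sub_dspace : dspace R :=
  @DSpace R (set_type A) sub_smooth restr_cst sub_smoothD sub_smoothM.

Lemma restr_subproof (f : Cinf X) :
  (fun q : sub_dspace => f (val q)) \in @smooth_pred R sub_dspace.
Proof. by apply/asboolP => p; exists f; apply: filterE. Qed.

Definition restr (f : Cinf X) : Cinf sub_dspace := MkCinf (restr_subproof f).

End Subspace.

Section Diffeomorphism.
Variables (R : realType) (X Y : dspace R).

Record diffeo := Diffeo {
  dfun :> X -> Y;
  dinv : Y -> X;
  dfunK : cancel dfun dinv;
  dinvK : cancel dinv dfun;
  dfun_continuous : continuous dfun;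
  dinv_continuous : continuous dinv;
  dfun_smooth : forall f : Cinf Y, smooth (f \o dfun);
  dinv_smooth : forall f : Cinf X, smooth (f \o dinv) }.

Definition pullback (g : diffeo) (f : Cinf Y) : Cinf X :=
  MkCinf (asboolT (dfun_smooth g f) : f \o g \in @smooth_pred R X).

Definition pushforward (g : diffeo) (D : vfield X) (E : vfield Y) : Prop :=
  forall f : Cinf Y, D (pullback g f) = pullback g (E f).

Definition orientation_preserving (g : diffeo) n
    (w1 : ('I_n -> vfield X) -> Cinf X) (w2 : ('I_n -> vfield Y) -> Cinf Y) :=
  forall (D : 'I_n -> vfield X) (E : 'I_n -> vfield Y),
    (forall i, pushforward g (D i) (E i)) ->
    forall p : X, 0 < w1 D p -> 0 < w2 E (g p).

End Diffeomorphism.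

Section Fibration.
Variables (R : realType) (Q : dspace R) (v : vfield Q) (f : Cinf Q).

Definition fiber (L : set Q) : Prop :=
  exists p : Q, L = connected_component [set q | f q = f p] p.

Definition regular_torus (L : set Q) : Prop :=
  fiber L /\ forall p, L p -> ~ critical f p.

(* Critical tori are counted as Liouville tori. The regular fibers need no
   further condition: they are tori by Liouville's theorem. *)
Definition liouville_torus (L : set Q) : Prop :=
  regular_torus L \/
  [/\ fiber L, forall p, L p -> critical f p & embedded_torus 2 L].

(* Isolated: a whole connected component of the critical set. *)
Definition critical_circle (L : set Q) : Prop :=
  (exists2 p : Q, critical f p &
     L = connected_component [set q | critical f q] p) /\
  embedded_torus 1 L.

(* Fibers where f attains a maximum or a minimum: critical tori, maximal or
   minimal circles, and Klein bottles. The first two are already among the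
   leaves below; Klein bottles are kept as leaves so that the leaves cover Q.
   Fields tangent to the neighbouring tori are tangent to them anyway. *)
Definition extremal_fiber (L : set Q) : Prop :=
  fiber L /\ forall p, L p -> critical f p.

(* Fibers with a singularity of the type of a fourfold line. *)
Definition hyperbolic_fiber (F : set Q) : Prop :=
  [/\ fiber F, exists2 p, F p & critical f p & exists2 p, F p & ~ critical f p].

Definition ring_leaf (L : set Q) : Prop :=
  exists2 F, hyperbolic_fiber F &
    let F' := F `\` \bigcup_(C in critical_circle) C in
    exists2 p, F' p & L = connected_component F' p.

Definition partition_leaf : set (set Q) :=
  [set L | [\/ liouville_torus L, critical_circle L, ring_leaf L
             | extremal_fiber L]].

(* v is, in suitable angle coordinates on L, a constant field of irrational
   slope. *)
Definition irrational_winding (L : set Q) : Prop :=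
  exists (T : 'rV[R]_2 -> Q) (w : 'rV[R]_2),
    [/\ torus_param T L,
        forall (g : Cinf Q) s, v g (T s) = 'D_w (g \o T) s
      & forall m n : int,
          m%:~R * w 0 ord0 + n%:~R * w 0 ord_max = 0 -> m = 0 /\ n = 0].

Definition nonresonant : Prop :=
  dense (\bigcup_(L in [set L | liouville_torus L /\ irrational_winding L]) L).

End Fibration.

Record bott_system (R : realType) := BottSystem {
  phase : dspace R;
  phase_manifold : manifold phase 4;
  omega : ('I_2 -> vfield phase) -> Cinf phase;
  omega_symplectic : symplectic omega;
  ham : Cinf phase;
  ham_field : vfield phase;
  ham_field_sgrad : sgrad omega ham ham_field;
  energy : R;
  energy_regular : forall p : phase, ham p = energy -> ~ critical ham p;
  isoenergetic : dspace R := sub_dspace [set p : phase | ham p = energy];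
  isoenergetic_closed : closed_manifold isoenergetic 3;
  orientation : ('I_3 -> vfield isoenergetic) -> Cinf isoenergetic;
  orientation_volume : volume_form orientation;
  flow : vfield isoenergetic;
  flow_restr : forall (g : Cinf phase) (q : isoenergetic),
    flow (restr _ g) q = ham_field g (val q);
  integral : Cinf isoenergetic;
  integral_first : flow integral = 0;
  integral_bott : bott 3 integral;
  integral_independent : null 3 [set q | critical integral q];
  system_nonresonant : nonresonant flow integral }.

Definition topologically_equivalent (R : realType) (S1 S2 : bott_system R) :=
  exists g : diffeo (isoenergetic S1) (isoenergetic S2),
  [/\ orientation_preserving g (@orientation R S1) (@orientation R S2),
      forall L, liouville_torus (integral S1) L <->
                liouville_torus (integral S2) (g @` L),
      forall C, critical_circle (integral S1) C <->
                critical_circle (integral S2) (g @` C)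
    & forall C, critical_circle (integral S1) C -> forall p, C p ->
        exists2 c : R, 0 < c & forall f : Cinf (isoenergetic S2),
          flow S1 (pullback g f) p = c * flow S2 f (g p)].

Definition HP_system (R : realType) (S : bott_system R) (k : nat) : zmodType :=
  HP (partition_leaf (integral S)) k.

Definition group_isomorphic (U V : zmodType) : Prop :=
  exists h : {additive U -> V}, bijective h.

(* Main.v *)
Require Import Defs.
From HB Require Import structures.
From mathcomp Require Import all_boot all_order all_algebra.
From mathcomp Require Import all_classical all_reals all_analysis.
From mathcomp Require Import ring lra.

Set Implicit Arguments.
Unset Strict Implicit.
Unset Printing Implicit Defensive.

Import Order.TTheory GRing.Theory Num.Theory.
Import numFieldNormedType.Exports.

Local Open Scope classical_set_scope.
Local Open Scope ring_scope.

(** The complex that defines the cohomology depends on the partition only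
through the Lie algebra of the fields tangent to the leaves, and this Lie
algebra is already determined by the Liouville tori: a field D is tangent to
all leaves iff D f = 0 iff D is tangent to all Liouville tori ([tangent_allP]).
A diffeomorphism that exchanges the Liouville tori of two systems therefore
conjugates the two Lie algebras, and, together with the pull-back of functions,
it induces an isomorphism of the complexes ([HP_isomorphic]).

A field tangent to the tori kills f on their union, since f is constant on each
of them; by nonresonance this union is dense, so D f = 0. Conversely, let
D f = 0 and let p be a point of a leaf L. It is enough to find a continuous
curve in L that starts at p with the velocity of D at p: a function that
vanishes on L near p vanishes along this curve, hence has derivative 0 in the
direction of D ([tangent_to_leaf]). If p is a regular point of f, the implicit
function theorem gives such a curve in the level of f through p
([regular_first_order_curve]). If p is critical, differentiating D f = 0 at p
shows that the velocity of D lies in the kernel of the Hessian of f; as f is a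
Bott function, this is the tangent space of the critical manifold, and a
straight line in a slice chart will do ([critical_first_order_curve]). In both
cases f is constant along the curve, and either all of its points are critical
or none is; whatever the kind of the leaf L, a connected set through p with
these two properties is contained in L ([leaf_absorb]).

Vector fields being derivations of the algebra of smooth functions, and critical
points being defined by derivations at a point, coordinates come in through the
classical fact that such a derivation is a combination of the partial
derivatives ([tangent_vector_partials]). It rests on the lemma of Hadamard
([hadamard]), whose coefficients are integrals depending smoothly on a
parameter ([Ck_dilation_integral]), and on bump functions ([manifold_bump]),
which make derivations local. The lemma of Hadamard also yields the chain rule
along curves ([is_derive_curve]) and the symmetry of second derivatives
([partial_comm]). *)

Local Notation "''e_' i" := (delta_mx (0 : 'I_1) i) (at level 8, i at level 2).
Local Notation coord := Defs.coord.
Local Notation nondegenerate := Defs.nondegenerate.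

(** * Functions of class C^k on open subsets of R^n *)

Lemma open_near (T : topologicalType) (U : set T) (P : T -> Prop) x :
  open U -> U x -> (forall y, U y -> P y) -> \forall y \near x, P y.
Proof.
by move=> oU Ux UP; have /filterS := open_nbhs_nbhs (conj oU Ux); apply.
Qed.

Lemma cvg_near_eq (I : Type) (T : topologicalType) (FF : set_system I)
    {PF : Filter FF} (f g : I -> T) (l : T) :
  (\forall x \near FF, f x = g x) -> g x @[x --> FF] --> l ->
  f x @[x --> FF] --> l.
Proof.
by move=> fg gl; apply: cvg_trans gl; apply: near_eq_cvg; apply: filterS fg.
Qed.

Lemma near_eq_continuous (T S : topologicalType) (f g : T -> S) x :
  (\forall y \near x, f y = g y) -> {for x, continuous f} ->
  {for x, continuous g}.
Proof.
move=> fg; rewrite /prop_for /continuous_at -(nbhs_singleton fg) => cf.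
by apply: cvg_trans cf; apply: near_eq_cvg; apply: filterS fg => y ->.
Qed.

Lemma continuous_dist (R : realType) (T : topologicalType) (f : T -> R) x :
  (forall e : R, 0 < e -> \forall y \near x, `|f y - f x| <= e) ->
  {for x, continuous f}.
Proof.
move=> H; apply/cvgrPdist_le => e e0.
by apply: filterS (H e e0) => y; rewrite distrC.
Qed.

Section SmoothCalculus.
Variables (R : realType) (n : nat).
Implicit Types (U V : set 'rV[R]_n) (F G : 'rV[R]_n -> R).

Lemma Ck_subset k U V F : V `<=` U -> Ck k U F -> Ck k V F.
Proof.
move=> VU; elim: k F => [|k IH] F [cF dF]; split=> //; try by move=> x /VU/cF.
move=> i; have [d1 d2] := dF i; split; first by move=> x /VU/d1.
exact: IH.
Qed.

Lemma CkW k U F : Ck k.+1 U F -> Ck k U F.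
Proof.
elim: k F => [|k IH] F [cF dF]; split=> // i; have [d1 d2] := dF i.
by split=> //; exact: IH.
Qed.

Lemma eq_Ck k U F G : open U -> {in U, F =1 G} -> Ck k U F -> Ck k U G.
Proof.
move=> oU; elim: k F G => [|k IH] F G FG [cF dF];
  have nearFG x : U x -> \forall y \near x, F y = G y
    by move=> Ux; apply: open_near oU Ux _ => y Uy; apply: FG; rewrite inE.
  by split=> // x Ux; apply: near_eq_continuous (nearFG x Ux) (cF x Ux).
split=> [x Ux|i]; first by apply: near_eq_continuous (nearFG x Ux) (cF x Ux).
have [d1 d2] := dF i; split=> [x Ux|].
  by apply: near_eq_derivable (d1 x Ux); exact: nearFG.
apply: IH d2 => x; rewrite inE => Ux.
by apply: near_eq_derive; exact: nearFG.
Qed.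

Lemma Ck_cst k U (c : R) : Ck k U (cst c).
Proof.
elim: k c => [|k IH] c; split=> //; try by move=> x _; apply: cst_continuous.
move=> i; split=> [x _|]; first exact: (derivable_cst c x _).
rewrite (_ : (fun _ => _) = cst 0); first exact: IH.
by apply/funext => x; rewrite derive_cst.
Qed.

Lemma CkD k U F G : open U -> Ck k U F -> Ck k U G -> Ck k U (F + G).
Proof.
move=> oU; elim: k F G => [|k IH] F G [cF dF] [cG dG].
  by split=> // x Ux; exact: (continuousD (cF x Ux) (cG x Ux)).
split=> [x Ux|i]; first by exact: (continuousD (cF x Ux) (cG x Ux)).
have [dF1 dF2] := dF i; have [dG1 dG2] := dG i.
split=> [x Ux|]; first by apply: derivableD; [exact: dF1|exact: dG1].
apply: eq_Ck (IH _ _ dF2 dG2) => // x; rewrite inE => Ux.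
by rewrite deriveD //; [exact: dF1|exact: dG1].
Qed.

Lemma CkM k U F G : open U -> Ck k U F -> Ck k U G -> Ck k U (F * G).
Proof.
move=> oU; elim: k F G => [|k IH] F G hF hG.
  case: hF hG => [cF _] [cG _].
  by split=> // x Ux; exact: (continuousM (cF x Ux) (cG x Ux)).
have hFk := CkW hF; have hGk := CkW hG.
case: hF hG => [cF dF] [cG dG].
split=> [x Ux|i]; first by exact: (continuousM (cF x Ux) (cG x Ux)).
have [dF1 dF2] := dF i; have [dG1 dG2] := dG i.
split=> [x Ux|]; first by apply: derivableM; [exact: dF1|exact: dG1].
apply: eq_Ck (CkD oU (IH _ _ hFk dG2) (IH _ _ hGk dF2)) => // x.
by rewrite inE => Ux; rewrite deriveM //; [exact: dF1|exact: dG1].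
Qed.

Lemma Ck_continuous k U F x : Ck k U F -> U x -> {for x, continuous F}.
Proof. by case: k => [|k] [cF _] Ux; exact: cF. Qed.

Lemma Ck_partial k U F i : Ck k.+1 U F -> Ck k U ('D_('e_i) F).
Proof. by case=> _ /(_ i)[]. Qed.

Lemma is_derive_cvg (V : normedModType R) (F : V -> R) (x v : V) (d : R) :
  (h^-1 * (F (h *: v + x) - F x)) @[h --> 0^'] --> d -> is_derive x v F d.
Proof.
move=> hd; apply: DeriveDef; last exact: cvg_lim hd.
by apply/cvg_ex; exists d.
Qed.

Lemma cvg_is_derive (V : normedModType R) (F : V -> R) (x v : V) (d : R) :
  is_derive x v F d -> (h^-1 * (F (h *: v + x) - F x)) @[h --> 0^'] --> d.
Proof. by case=> /[swap] <-. Qed.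

(** Reduces directional derivatives to derivatives of functions of one real
variable, for which the chain rule and the mean value theorem are at hand. *)
Lemma is_derive_line (V : normedModType R) (F : V -> R) (x v : V) (d : R) :
  is_derive x v F d <-> is_derive (0 : R) 1 (fun t => F (x + t *: v)) d.
Proof.
have E : (fun h => h^-1 * (F (h *: v + x) - F x)) =
    (fun h => h^-1 * (F (x + (h *: (1 : R) + 0 : R) *: v) - F (x + 0 *: v))).
  by apply/funext => h; rewrite scale0r !addr0 [_%:A]mulr1 [_ *: v + x]addrC.
split=> /cvg_is_derive hd; apply: is_derive_cvg; first by rewrite -E.
by rewrite E.
Qed.

Lemma derive_coord (v x : 'rV[R]_n) (j : 'I_n) :
  is_derive x v (fun y : 'rV[R]_n => y 0 j) (v 0 j).
Proof.
apply: is_derive_cvg; apply: cvg_near_eq (cvg_cst (v 0 j)).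
near=> h; rewrite !mxE addrK mulKf //; near: h; exact: nbhs_dnbhs_neq.
Unshelve. all: by end_near. Qed.

Lemma Ck_coord k U (j : 'I_n) : Ck k U (fun y => y 0 j).
Proof.
case: k => [|k]; split=> //; try by move=> x _; exact: coord_continuous.
move=> i; split=> [x _|]; first by have [] := derive_coord 'e_i x j.
rewrite (_ : (fun _ => _) = cst (('e_i : 'rV[R]_n) 0 j)); first exact: Ck_cst.
by apply/funext => x; have [_ ->] := derive_coord 'e_i x j.
Qed.

Lemma cvg_rV (I : Type) (FF : set_system I) {PF : Filter FF}
    (f : I -> 'rV[R]_n) (l : 'rV[R]_n) :
  (forall j, f x 0 j @[x --> FF] --> l 0 j) -> f @ FF --> l.
Proof.
move=> fl; apply/cvg_ballP => e e0.
have : \forall x \near FF, forall j, ball (l 0 j) e (f x 0 j).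
  by apply: filter_forall => j; exact: (cvg_ball (fl j)).
apply: filterS => x fx; split=> // i j; rewrite (ord1 i); exact: fx.
Qed.

End SmoothCalculus.

(** * Dilations and integrals depending on a parameter *)

Section Integral.
Variable R : realType.

Local Notation mu := (@lebesgue_measure R).
Local Notation I01 := (`[0, 1]%classic : set R).

(** The tube lemma: this is the uniformity that allows taking limits and
derivatives under an integral over K. *)
Lemma near_compact_dist (T : topologicalType) (K : set R) (Psi : T -> R -> R) y :
  compact K ->
  (forall t, K t -> {for (y, t), continuous (fun z : T * R => Psi z.1 z.2)}) ->
  forall e, 0 < e ->
  \forall y' \near y, forall t, K t -> `|Psi y' t - Psi y t| <= e.
Proof.
move=> /compact_near_coveringP cK cPsi e e0.
apply: (cK T (nbhs y) (fun y' t => `|Psi y' t - Psi y t| <= e)) => t Kt.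
have e20 : 0 < e / 2 by rewrite divr_gt0.
have /cvgrPdist_lt/(_ _ e20) [[A B] /= [yA tB] AB] := cPsi t Kt.
exists (B, A) => //= -[t' y'] /= [Bt' Ay'].
have h1 := AB (y', t') (conj Ay' Bt').
have h2 := AB (y, t') (conj (nbhs_singleton yA) Bt').
rewrite /= in h1 h2; rewrite (splitr e) -(subrKA (Psi y t)).
by rewrite (le_trans (ler_normD _ _)) // lerD // ltW // distrC.
Qed.

Lemma integrable01 (f : R -> R) :
  {within I01, continuous f} -> mu.-integrable I01 (EFin \o f).
Proof.
move=> cf; apply: continuous_compact_integrable => //; exact: segment_compact.
Qed.

Lemma int01_cst (c : R) : \int[mu]_(t in I01) c = c.
Proof.
rewrite Rintegral_cst //= lebesgue_measure_itv /= lte_fin ltr01 oppr0 adde0.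
by rewrite mulr1.
Qed.

Lemma int01_dist (f g : R -> R) (e : R) :
  {within I01, continuous f} -> {within I01, continuous g} ->
  (forall t, I01 t -> `|f t - g t| <= e) ->
  `|\int[mu]_(t in I01) f t - \int[mu]_(t in I01) g t| <= e.
Proof.
move=> cf cg fg.
have cfg : {within I01, continuous (fun t => f t - g t)}.
  by move=> t; apply: cvgB; [exact: cf|exact: cg].
rewrite -RintegralB //; [|exact: integrable01..].
apply: le_trans (le_normr_Rintegral _ _) _ => //; first exact: integrable01.
rewrite -[leRHS]int01_cst; apply: le_Rintegral => //.
- apply: integrable01 => t.
  exact: (cvg_norm (cfg t)).
- by apply: integrable01; apply: continuous_subspaceT; exact: cst_continuous.
Qed.

End Integral.

Section Dilation.
Variables (R : realType) (n : nat).
Implicit Types (x y a : 'rV[R]_n) (F G : 'rV[R]_n -> R).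

Lemma is_derive_along F x (v : 'rV[R]_n) (c s : R) :
  derivable F (x + (s * c) *: v) v ->
  is_derive s 1 (fun s => F (x + (s * c) *: v))
    (c * 'D_v F (x + (s * c) *: v)).
Proof.
set x' := x + (s * c) *: v => /derivableP/is_derive_line dF.
have dg : is_derive s 1 (fun t : R => (t - s) * c) c.
  apply: is_derive_cvg; apply: cvg_near_eq (cvg_cst c).
  near=> h; rewrite subrr mul0r subr0 addrK [_%:A]mulr1 mulKf //.
  by near: h; exact: nbhs_dnbhs_neq.
have dF' : is_derive ((s - s) * c) 1 (fun t => F (x' + t *: v)) ('D_v F x').
  by rewrite subrr mul0r.
rewrite mulrC (_ : (fun _ => _) = (fun t => F (x' + t *: v)) \o
  (fun t : R => (t - s) * c)); first exact: is_derive1_comp.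
apply/funext => t /=; rewrite /x' -addrA -scalerDl; congr (F (_ + _ *: _)).
by rewrite -mulrDl addrC subrK.
Unshelve. all: by end_near. Qed.

(** Coordinatewise homothety of centre a. A different factor in each coordinate
covers straight paths and the broken paths of the lemma of Hadamard alike. *)
Definition dilate (c : 'I_n -> R) a y : 'rV[R]_n :=
  \row_j (a 0 j + c j * (y 0 j - a 0 j)).

Lemma ball_rV a (r : R) y :
  ball a r y <-> 0 < r /\ forall j, `|a 0 j - y 0 j| < r.
Proof.
split=> [[r0 H]|[r0 H]]; first by split=> // j; exact: (H 0 j).
by split=> // i j; rewrite (ord1 i); exact: H.
Qed.

Lemma dilate_ball (c : 'I_n -> R) a (r : R) y :
  (forall j, 0 <= c j <= 1) -> ball a r y -> ball a r (dilate c a y).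
Proof.
move=> c01 /ball_rV[r0 ay]; apply/ball_rV; split=> // j; rewrite mxE.
have /andP[c0 c1] := c01 j.
rewrite opprD addNKr normrN normrM ger0_norm //.
by apply: le_lt_trans (ay j); rewrite distrC ler_piMl.
Qed.

(** A dilation maps lines parallel to an axis to lines parallel to the same
axis, so partial derivatives of a composite with a dilation need no total
differential. *)
Lemma dilate_add (c : 'I_n -> R) a y (s : R) i :
  dilate c a (y + s *: 'e_i) = dilate c a y + (s * c i) *: 'e_i.
Proof.
apply/rowP => j; rewrite !mxE eqxx /=; case: eqVneq => [->|_] /=; ring.
Qed.

Lemma dilate_continuous (c : R -> 'I_n -> R) a y (t : R) :
  (forall j, continuous (c ^~ j)) ->
  {for (y, t), continuous (fun z : 'rV[R]_n * R => dilate (c z.2) a z.1)}.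
Proof.
move=> cc; apply: cvg_rV => j.
rewrite (_ : (fun _ => _) = fun z : 'rV[R]_n * R =>
    a 0 j + c z.2 j * (z.1 0 j - a 0 j)); last first.
  by apply/funext => z; rewrite mxE.
rewrite mxE; apply: cvgD; first exact: cvg_cst.
apply: cvgM.
  by apply: (@cvg_comp _ _ _ snd (c ^~ j)); [exact: cvg_snd|exact: cc].
apply: cvgB; last exact: cvg_cst.
apply: (@cvg_comp _ _ _ fst (fun x : 'rV[R]_n => x 0 j)); first exact: cvg_fst.
exact: coord_continuous.
Qed.

End Dilation.

Section IntegralDerive.
Variable R : realType.
Local Notation mu := (@lebesgue_measure R).
Local Notation I01 := (`[0, 1]%classic : set R).

Lemma is_derive_int01 (f df : R -> R -> R) (d : R) : 0 < d ->
  (forall s, `|s| < d -> {within I01, continuous (f s)}) ->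
  (forall (s : R) t, `|s| < d -> I01 t -> is_derive s 1 (f ^~ t) (df s t)) ->
  {within I01, continuous (df 0)} ->
  (forall s t, `|s| < d -> I01 t -> `|df s t - df 0 t| <= 1) ->
  is_derive (0 : R) 1 (fun s => \int[mu]_(t in I01) f s t)
    (\int[mu]_(t in I01) df 0 t).
Proof.
move=> d0 cf hf cdf bdf.
have sd (s : R) : `]- d, d[%classic s -> `|s| < d by rewrite /= in_itv /= ltr_norml.
have Id0 : `]- d, d[%classic (0 : R) by rewrite /= in_itv /= oppr_lt0 d0.
pose M t := `|df 0 t| + 1.
have M0 t : 0 <= M t by rewrite addr_ge0.
have iM : mu.-integrable I01 (EFin \o M).
  apply: integrable01 => t; apply: cvgD; last exact: cvg_cst.
  exact: (cvg_norm (cdf t)).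
have if_ (s : R) : `]- d, d[%classic s -> mu.-integrable I01 (EFin \o f s).
  by move=> /sd sd'; apply: integrable01; exact: cf.
have df_ (s : R) t : `]- d, d[%classic s -> I01 t -> derivable (f ^~ t) s 1.
  by move=> /sd sd' It; have [] := hf s t sd' It.
have fM (s : R) t : `]- d, d[%classic s -> I01 t -> `|partial1of2 f s t| <= M t.
  move=> /sd sd' It; rewrite partial1of2E; have [_ ->] := hf s t sd' It.
  rewrite -[df s t](subrK (df 0 t)) addrC (le_trans (ler_normD _ _)) //.
  by rewrite lerD // bdf.
have mI : @measurable _ (measurableTypeR R) I01 by exact: measurable_itv.
apply: DeriveDef.
  exact: (@derivable_under_integral R _ (measurableTypeR R) mu f _ mI _ _ _ Id0
    if_ df_ _ M0 iM fM).
rewrite -derive1E.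
rewrite (@differentiation_under_integral R _ (measurableTypeR R) mu f _ mI _ _ _
  Id0 if_ df_ _ M0 iM fM).
apply: eq_Rintegral => t; rewrite inE => It.
by rewrite /= partial1of2E; have [_ ->] := hf 0 t (sd 0 Id0) It.
Qed.

End IntegralDerive.

Section DilationIntegral.
Variables (R : realType) (n : nat) (a : 'rV[R]_n) (r : R).
Variable c : R -> 'I_n -> R.
Hypothesis c_cont : forall j, continuous (c ^~ j).
Hypothesis c01 : forall t, `[0, 1]%classic t -> forall j, 0 <= c t j <= 1.

Local Notation mu := (@lebesgue_measure R).
Local Notation I01 := (`[0, 1]%classic : set R).
Local Notation B := (ball a r).

Let integrand (m : R -> R) (G : 'rV[R]_n -> R) (y : 'rV[R]_n) (t : R) :=
  m t * G (dilate (c t) a y).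

Let joint (m : R -> R) G (y : 'rV[R]_n) (t : R) :
  continuous m -> Ck 0 B G -> B y -> I01 t ->
  {for (y, t), continuous (fun z => integrand m G z.1 z.2)}.
Proof.
move=> cm [cG _] By It; apply: cvgM.
  by apply: (@cvg_comp _ _ _ snd m); [exact: cvg_snd|exact: cm].
apply: (@cvg_comp _ _ _ (fun z : 'rV[R]_n * R => dilate (c z.2) a z.1) G).
  exact: dilate_continuous.
by apply: cG; apply: dilate_ball => //; exact: c01.
Qed.

Lemma dilation_integrand_continuous (m : R -> R) G (y : 'rV[R]_n) :
  continuous m -> Ck 0 B G -> B y ->
  {within I01, continuous (fun t => m t * G (dilate (c t) a y))}.
Proof.
move=> cm cG By; apply: continuous_in_subspaceT => t; rewrite inE => It.
have cpair : (fun s : R => (y, s)) @ t --> (y, t).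
  by apply: (cvg_pair (cvg_cst y) cvg_id).
exact: (cvg_comp _ (fun z : 'rV[R]_n * R => integrand m G z.1 z.2) cpair
  (joint cm cG By It)).
Qed.

(** The partial derivative of such an integral along the i-th axis is an
integral of the same form, with weight m t * c t i and the i-th partial
derivative of G in place of G. The generality in m and G is what makes the
induction on k go through. *)
Lemma Ck_dilation_integral k (m : R -> R) (G : 'rV[R]_n -> R) :
  continuous m -> Cinfty_on B G ->
  Ck k B (fun y => \int[mu]_(t in I01) (m t * G (dilate (c t) a y))).
Proof.
have nearB (y : 'rV[R]_n) : B y -> \forall y' \near y, B y'.
  by move=> By; apply: open_near By _ => //; exact: ball_open.
elim: k m G => [|k IH] m G cm hG.
  split=> // y By; apply: continuous_dist => e e0.
  have near_dist := near_compact_dist (@segment_compact R 0 1)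
    (fun t It => joint cm (hG 0%N) By It) e0.
  near=> y'; apply: int01_dist; [apply: dilation_integrand_continuous => //..|].
    by near: y'; exact: nearB.
  by near: y'; exact: near_dist.
split=> [y By|i]; first exact: Ck_continuous (IH m G cm hG) By.
have cmi : continuous (fun t => m t * c t i).
  by move=> t; apply: cvgM; [exact: cm|exact: c_cont].
have hDG : Cinfty_on B ('D_('e_i) G) by move=> l; exact: Ck_partial (hG l.+1).
have IHi := IH _ _ cmi hDG.
have der y : B y -> is_derive y 'e_i
    (fun y => \int[mu]_(t in I01) (m t * G (dilate (c t) a y)))
    (\int[mu]_(t in I01) (m t * c t i * 'D_('e_i) G (dilate (c t) a y))).
  move=> By; apply/is_derive_line.
  have : \forall s \near (0 : R), B (y + s *: 'e_i) /\ forall t, I01 t ->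
      `|integrand (fun t => m t * c t i) ('D_('e_i) G) (y + s *: 'e_i) t
        - integrand (fun t => m t * c t i) ('D_('e_i) G) y t| <= 1.
    have cl : (y + s *: 'e_i) @[s --> (0 : R)] --> y.
      rewrite -[X in _ --> X]addr0 -(scale0r 'e_i); apply: cvgD; first exact: cvg_cst.
      by apply: cvgZl; exact: cvg_id.
    have near_dist := near_compact_dist (@segment_compact R 0 1)
      (fun t It => joint cmi (hDG 0%N) By It) ltr01.
    by near=> s; split; near: s;
      [exact: (cl _ (nearB y By))|exact: (cl _ near_dist)].
  move=> /nbhs_ballP[d /= d0 Hd].
  have ball0 (s : R) : `|s| < d -> ball 0 d s.
    by move=> sd; rewrite /ball /= sub0r normrN.
  have sB (s : R) : `|s| < d -> B (y + s *: 'e_i) by move=> /ball0/Hd[].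
  have y0 : y + (0 : R) *: 'e_i = y by rewrite scale0r addr0.
  pose f (s t : R) := integrand m G (y + s *: 'e_i) t.
  pose df (s t : R) :=
    integrand (fun t => m t * c t i) ('D_('e_i) G) (y + s *: 'e_i) t.
  have -> : (fun t : R => m t * c t i * 'D_('e_i) G (dilate (c t) a y)) = df 0.
    by rewrite /df y0.
  apply: (@is_derive_int01 R f df d d0) => [s sd|s t sd It||s t sd It].
  - by apply: dilation_integrand_continuous => //; exact: sB.
  - rewrite /df /f /integrand -mulrA.
    rewrite (_ : (fun _ => _) = m t \*:
      (fun s => G (dilate (c t) a y + (s * c t i) *: 'e_i))); last first.
      by apply/funext => s'; rewrite dilate_add.
    rewrite dilate_add; apply: is_deriveZ; apply: is_derive_along.
    rewrite -dilate_add; apply: ((hG 1%N).2 i).1; apply: dilate_ball.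
      exact: c01.
    exact: sB.
  - by rewrite /df y0; apply: dilation_integrand_continuous.
  - by have [_] := Hd s (ball0 s sd); rewrite /df y0; apply.
split=> [y By|]; first by have [] := der y By.
apply: eq_Ck IHi; first exact: ball_open.
by move=> y; rewrite inE => By; have [_ ->] := der y By.
Unshelve. all: by end_near. Qed.

End DilationIntegral.

(** * Hadamard's lemma *)

Section Hadamard.
Variables (R : realType) (n : nat).
Implicit Types (a y : 'rV[R]_n) (F G : 'rV[R]_n -> R).

Local Notation mu := (@lebesgue_measure R).
Local Notation I01 := (`[0, 1]%classic : set R).

(** Factors of the dilation that follows the k-th edge of the path from a to y
that moves one coordinate after the other: the coordinates below k have arrived,
the k-th one is on its way, the others have not left. *)
Definition broken_path (k : 'I_n) (t : R) (j : 'I_n) : R :=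
  if (j < k)%N then 1 else if j == k then t else 0.

Definition broken_node a y (k : nat) : 'rV[R]_n :=
  dilate (fun j : 'I_n => (j < k)%N%:R) a y.

Lemma broken_path_continuous k j : continuous (broken_path k ^~ j).
Proof.
rewrite /broken_path; case: (j < k)%N; first exact: cst_continuous.
by case: (j == k) => // t; [exact: cvg_id|exact: cst_continuous].
Qed.

Lemma broken_path01 k t : I01 t -> forall j, 0 <= broken_path k t j <= 1.
Proof.
move=> It j; rewrite /broken_path; case: ifP => _; first by rewrite ler01 lexx.
case: ifP => _; last by rewrite lexx ler01.
by move: It; rewrite /= in_itv.
Qed.

Lemma broken_pathE (k : 'I_n) a y (t : R) :
  dilate (broken_path k t) a y =
  broken_node a y k + (t * (y 0 k - a 0 k)) *: 'e_k.
Proof.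
apply/rowP => j; rewrite !mxE eqxx /= /broken_path.
case: (ltnP j k) => [jk|kj]; case: eqVneq => [E|_] /=; rewrite ?E; try ring.
by move: jk; rewrite E ltnn.
Qed.

(** F y - F a is telescoped along the broken path from a to y. The increment on
the k-th edge is, by the fundamental theorem of calculus, y_k - a_k times the
integral of the k-th partial derivative along that edge. A broken path is used
rather than the segment because only partial derivatives occur along it: the
chain rule is a consequence of this lemma, not an ingredient. *)
Lemma hadamard a (r : R) F : Cinfty_on (ball a r) F ->
  exists K : 'I_n -> 'rV[R]_n -> R, (forall i, Cinfty_on (ball a r) (K i)) /\
    forall y, ball a r y -> F y = F a + \sum_i (y 0 i - a 0 i) * K i y.
Proof.
move=> hF.
have hDF i : Cinfty_on (ball a r) ('D_('e_i) F).
  by move=> l; exact: Ck_partial (hF l.+1).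
pose K i y : R :=
  \int[mu]_(t in I01) (1 * 'D_('e_i) F (dilate (broken_path i t) a y)).
exists K; split=> [i k|y By].
  have c1 : continuous (cst 1 : R -> R) by exact: cst_continuous.
  exact: (Ck_dilation_integral (@broken_path_continuous i)
    (@broken_path01 i) k c1 (hDF i)).
have node_n : broken_node a y n = y.
  by apply/rowP => j; rewrite mxE ltn_ord mul1r addrC subrK.
have node_0 : broken_node a y 0 = a.
  by apply/rowP => j; rewrite mxE ltn0 mul0r addr0.
apply/eqP; rewrite addrC -subr_eq -{1}node_n -{2}node_0.
rewrite -(telescope_sumr (fun k => F (broken_node a y k))) // big_mkord.
apply/eqP; apply: eq_bigr => k _.
set c := y 0 k - a 0 k.
pose g (t : R) := F (broken_node a y k + (t * c) *: 'e_k).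
pose dg (t : R) := c * (1 * 'D_('e_k) F (dilate (broken_path k t) a y)).
have Bpath t : I01 t -> ball a r (dilate (broken_path k t) a y).
  by move=> It; apply: dilate_ball => // j; exact: broken_path01.
have der t : I01 t -> is_derive t 1 g (dg t).
  move=> It; rewrite /dg mul1r broken_pathE; apply: is_derive_along.
  by rewrite -broken_pathE; apply: ((hF 1%N).2 k).1; exact: Bpath.
have cint (m : R) : {within I01,
    continuous (fun t => m * 'D_('e_k) F (dilate (broken_path k t) a y))}.
  have cm : continuous (cst m : R -> R) by exact: cst_continuous.
  exact: (dilation_integrand_continuous (@broken_path_continuous k)
    (@broken_path01 k) cm (hDF k 0%N) By).
have dgc : {within I01, continuous dg}.
  by rewrite (_ : dg = (fun t => c * 'D_('e_k) F (dilate (broken_path k t) a y)))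
    //; apply/funext => t; rewrite /dg mul1r.
have gc t : I01 t -> {for t, continuous g}.
  move=> It; apply: differentiable_continuous; apply/derivable1_diffP.
  by have [] := der t It.
have I0 : I01 0 by rewrite /= in_itv /= lexx ler01.
have I1 : I01 1 by rewrite /= in_itv /= lexx ler01.
have sub t : t \in `]0, 1[%R -> I01 t.
  by rewrite /= !in_itv /= => /andP[/ltW -> /ltW ->].
have FTC : (\int[mu]_(t in I01) (dg t)%:E)%E = ((g 1)%:E - (g 0)%:E)%E.
  apply: continuous_FTC2 => //.
    split=> [t /sub It| |]; first by have [] := der t It.
      by apply: cvg_at_right_filter; exact: gc.
    by apply: cvg_at_left_filter; exact: gc.
  by move=> t /sub It; rewrite derive1E; have [_ ->] := der t It.
have -> : broken_node a y k.+1 = broken_node a y k + (1 * c) *: 'e_k.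
  rewrite -broken_pathE; apply/rowP => j; rewrite !mxE /broken_path ltnS.
  rewrite leq_eqVlt (_ : (j == k :> nat) = (j == k)) //.
  by case: ltnP => [_|_]; rewrite ?orbT //= orbF; case: eqP.
have -> : F (broken_node a y k) = g 0 by rewrite /g mul0r scale0r addr0.
rewrite -/(g 1).
have -> : g 1 - g 0 = fine (\int[mu]_(t in I01) (dg t)%:E)%E by rewrite FTC.
rewrite /K -RintegralZl //; apply: integrable01; exact: cint.
Qed.

End Hadamard.

(** * Chain rule along curves and symmetry of second derivatives *)

Section ChainRule.
Variables (R : realType) (n : nat).
Implicit Types (a y : 'rV[R]_n) (F G : 'rV[R]_n -> R).

Lemma Cinfty_at_near a F : Cinfty_at a F -> \forall y \near a, Cinfty_at y F.
Proof.
by move=> [U [oU Ua hF]]; apply: (open_near oU Ua) => y Uy; exists U.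
Qed.

Lemma eq_Cinfty_at a F G : (\forall y \near a, F y = G y) ->
  Cinfty_at a F -> Cinfty_at a G.
Proof.
move=> FG [U [oU Ua hF]].
exists (U `&` [set y | F y = G y]°); split.
- by apply: openI => //; exact: open_interior.
- by split.
- move=> k; apply: (@eq_Ck _ _ _ _ F).
  + by apply: openI => //; exact: open_interior.
  + by move=> y; rewrite inE => -[_ /interior_subset].
  + by apply: Ck_subset (hF k) => y [].
Qed.

Lemma Cinfty_at_ball a F : Cinfty_at a F ->
  exists2 r : R, 0 < r & Cinfty_on (ball a r) F.
Proof.
move=> [U [oU Ua hF]].
have /nbhs_ballP[r /= r0 rU] : nbhs a U by exact: open_nbhs_nbhs.
by exists r => // k; apply: Ck_subset (hF k).
Qed.

Lemma Cinfty_on_ball_at a (r : R) F y :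
  Cinfty_on (ball a r) F -> ball a r y -> Cinfty_at y F.
Proof. by move=> hF By; exists (ball a r); split=> //; exact: ball_open. Qed.

Lemma Cinfty_at_continuous a F : Cinfty_at a F -> {for a, continuous F}.
Proof. by move=> [U [_ Ua /(_ 0%N) hF]]; exact: Ck_continuous hF Ua. Qed.

Lemma Cinfty_at_derivable a F i : Cinfty_at a F -> derivable F a 'e_i.
Proof. by move=> [U [_ Ua /(_ 1%N)[_ /(_ i)[h _]]]]; exact: h. Qed.

Lemma Cinfty_at_partial a F i : Cinfty_at a F -> Cinfty_at a ('D_('e_i) F).
Proof.
by move=> [U [oU Ua hF]]; exists U; split=> // k; exact: Ck_partial (hF k.+1).
Qed.

Lemma is_derive1_continuous (u : R -> R) (t w : R) :
  is_derive t 1 u w -> {for t, continuous u}.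
Proof.
by case=> du _; apply: differentiable_continuous; apply/derivable1_diffP.
Qed.

(** The factor v only has to be continuous because u vanishes at t: this is how
an expansion with continuous coefficients gives a derivative. *)
Lemma is_derive_mul_zero (u v : R -> R) (t w : R) : u t = 0 ->
  is_derive t 1 u w -> {for t, continuous v} ->
  is_derive t 1 (fun s => u s * v s) (w * v t).
Proof.
move=> ut0 /cvg_is_derive du cv; apply: is_derive_cvg.
apply: (@cvg_near_eq _ _ _ _ _ (fun h : R =>
  (h^-1 * (u (h *: 1 + t) - u t)) * v (h *: 1 + t))).
  by near=> h; rewrite ut0 mul0r !subr0 mulrA.
apply: cvgM => //.
have cl0 : (h *: (1 : R) + t) @[h --> (0 : R)] --> ((0 : R) *: (1 : R) + t : R).
  by apply: cvgD; [apply: cvgZl; exact: cvg_id|exact: cvg_cst].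
have cl : (h *: (1 : R) + t) @[h --> (0 : R)^'] --> t.
  by move: cl0; rewrite scale0r add0r => cl0; exact: cvg_within_filter cl0.
exact: (cvg_comp _ _ cl cv).
Unshelve. all: by end_near. Qed.

Lemma curve_continuous (g : R -> 'rV[R]_n) (t : R) (w : 'I_n -> R) :
  (forall i, is_derive t 1 (fun s => g s 0 i) (w i)) -> {for t, continuous g}.
Proof. by move=> dg; apply: cvg_rV => i; exact: is_derive1_continuous (dg i). Qed.

Lemma is_derive_hadamard_curve a (r : R) F (K : 'I_n -> 'rV[R]_n -> R) :
  0 < r -> (forall i, {for a, continuous (K i)}) ->
  (forall y, ball a r y -> F y = F a + \sum_i (y 0 i - a 0 i) * K i y) ->
  forall (g : R -> 'rV[R]_n) (t : R) (w : 'I_n -> R), g t = a ->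
  (forall i, is_derive t 1 (fun s => g s 0 i) (w i)) ->
  is_derive t 1 (F \o g) (\sum_i w i * K i a).
Proof.
move=> r0 cK FK g t w gt dg.
have cg := curve_continuous dg.
have near_eq : \forall s \near t,
    F a + \sum_i (g s 0 i - a 0 i) * K i (g s) = (F \o g) s.
  have nB : nbhs (g t) (ball a r) by rewrite gt; exact: nbhsx_ballx.
  by near=> s; rewrite /= -FK //; near: s; exact: (cg _ nB).
apply: near_eq_is_derive near_eq _.
rewrite -[X in is_derive _ _ _ X]add0r.
rewrite (_ : (fun _ => _) = cst (F a) +
  \sum_(i < n) (fun s : R => (g s 0 i - a 0 i) * K i (g s))); last first.
  by apply/funext => s; rewrite !fctE /=; congr (_ + _); rewrite fct_sumE.
apply: is_deriveD; apply: is_derive_sum => i.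
rewrite -[in K i a]gt; apply: is_derive_mul_zero.
- by rewrite gt subrr.
- by rewrite -[w i]subr0; apply: is_deriveB.
- by apply: (@continuous_comp _ _ _ g (K i)) => //; rewrite gt; exact: cK.
Unshelve. all: by end_near. Qed.

Lemma is_derive_segment a (v : 'rV[R]_n) (t : R) (i : 'I_n) :
  is_derive t 1 (fun s => (a + s *: v) 0 i) (v 0 i).
Proof.
apply: is_derive_cvg; apply: cvg_near_eq (cvg_cst (v 0 i)).
near=> h; rewrite !mxE [_%:A]mulr1 mulrDl.
have h0 : h != 0 by near: h; exact: nbhs_dnbhs_neq.
by field.
Unshelve. all: by end_near. Qed.

(** The coefficients at a are found by differentiating the expansion along the
lines through a parallel to the axes. *)
Lemma Cinfty_at_hadamard a F : Cinfty_at a F ->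
  exists (r : R) (K : 'I_n -> 'rV[R]_n -> R), [/\ 0 < r,
    Cinfty_on (ball a r) F,
    forall i, Cinfty_on (ball a r) (K i),
    forall y, ball a r y -> F y = F a + \sum_i (y 0 i - a 0 i) * K i y
  & forall i, K i a = 'D_('e_i) F a].
Proof.
move=> /Cinfty_at_ball[r r0 hF]; have [K [hK FK]] := hadamard hF.
exists r, K; split=> // i.
have cK j : {for a, continuous (K j)}.
  by apply: (Ck_continuous (hK j 0%N)); exact: ballxx.
have := is_derive_hadamard_curve r0 cK FK (g := fun s => a + s *: 'e_i) (t := 0)
  (w := fun j => ('e_i : 'rV[R]_n) 0 j).
rewrite scale0r addr0 => /(_ erefl (is_derive_segment a 'e_i 0)).
move=> H; have [_ ->] := (is_derive_line F a 'e_i _).2 H.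
rewrite (bigD1 i) //= mxE !eqxx mul1r big1 ?addr0 // => j ji.
by rewrite mxE eqxx (negPf ji) mul0r.
Qed.

Lemma is_derive_curve a F (g : R -> 'rV[R]_n) (t : R) (w : 'I_n -> R) :
  Cinfty_at a F -> g t = a ->
  (forall i, is_derive t 1 (fun s => g s 0 i) (w i)) ->
  is_derive t 1 (F \o g) (\sum_i w i * 'D_('e_i) F a).
Proof.
move=> /Cinfty_at_hadamard[r [K [r0 _ hK FK Ka]]] gt dg.
under eq_bigr do rewrite -Ka.
apply: is_derive_hadamard_curve FK _ _ _ gt dg => // i.
by apply: (Ck_continuous (hK i 0%N)); exact: ballxx.
Qed.

(** Differentiating the expansion F = F a + sum_l (y_l - a_l) K_l twice at a, the
terms with a factor y_l - a_l vanish, and what is left, D_i K_j + D_j K_i, is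
symmetric in i and j. *)
Lemma partial_comm a F i j : Cinfty_at a F ->
  'D_('e_i) ('D_('e_j) F) a = 'D_('e_j) ('D_('e_i) F) a.
Proof.
move=> /Cinfty_at_hadamard[r [K [r0 hF hK FK _]]].
suff H i' j' : 'D_('e_i') ('D_('e_j') F) a =
    'D_('e_i') (K j') a + 'D_('e_j') (K i') a.
  by rewrite !H addrC.
have Ba : ball a r a by exact: ballxx.
have hKat l y : ball a r y -> Cinfty_at y (K l).
  by move=> By; exact: Cinfty_on_ball_at (hK l) By.
have coordB l v y : is_derive y v (fun y : 'rV[R]_n => y 0 l - a 0 l) (v 0 l).
  by rewrite -[v 0 l]subr0; apply: is_deriveB; exact: derive_coord.
have DF y l : ball a r y -> 'D_('e_l) F y =
    K l y + \sum_m (y 0 m - a 0 m) * 'D_('e_l) (K m) y.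
  move=> By.
  have near_eq : \forall z \near y,
      (cst (F a) + \sum_(m < n) ((fun z : 'rV[R]_n => z 0 m - a 0 m) * K m)) z = F z.
    apply: (open_near (ball_open a r) By) => z Bz.
    by rewrite (FK z Bz) !fctE fct_sumE.
  have [|_ ->] := near_eq_is_derive near_eq (v := 'e_l) (df := K l y +
      \sum_m (y 0 m - a 0 m) * 'D_('e_l) (K m) y); last by [].
  rewrite -[K l y]add0r -addrA; apply: is_deriveD.
  have -> : K l y + \sum_m (y 0 m - a 0 m) * 'D_('e_l) (K m) y =
      \sum_m ((y 0 m - a 0 m) * 'D_('e_l) (K m) y + K m y * ('e_l : 'rV[R]_n) 0 m).
    rewrite big_split /= addrC; congr (_ + _).
    rewrite (bigD1 l) //= mxE !eqxx mulr1 big1 ?addr0 // => m ml.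
    by rewrite mxE eqxx (negPf ml) mulr0.
  apply: is_derive_sum => m; apply: is_deriveM => //.
  by apply: derivableP; apply: Cinfty_at_derivable; exact: hKat.
have DF' l : \forall z \near a, (K l + \sum_(m < n) (fun z : 'rV[R]_n => z 0 m - a 0 m) *
    'D_('e_l) (K m)) z = 'D_('e_l) F z.
  apply: (open_near (ball_open a r) Ba) => z Bz.
  by rewrite (DF z l Bz) !fctE fct_sumE.
have [|_ ->] := near_eq_is_derive (DF' j') (v := 'e_i')
  (df := 'D_('e_i') (K j') a + 'D_('e_j') (K i') a); last by [].
apply: is_deriveD.
  by apply: derivableP; apply: Cinfty_at_derivable; exact: hKat.
have -> : 'D_('e_j') (K i') a =
    \sum_m ((a 0 m - a 0 m) * 'D_('e_i') ('D_('e_j') (K m)) a +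
      'D_('e_j') (K m) a * ('e_i' : 'rV[R]_n) 0 m).
  rewrite (bigD1 i') //= mxE !eqxx subrr mul0r add0r mulr1 big1 ?addr0 //.
  by move=> m mi; rewrite mxE eqxx (negPf mi) mulr0 subrr mul0r addr0.
apply: is_derive_sum => m; apply: is_deriveM => //.
apply: derivableP; apply: Cinfty_at_derivable; apply: Cinfty_at_partial.
exact: hKat.
Qed.

End ChainRule.

(** * Bump functions *)

Section Flat.
Variable R : realType.

(** The factor t ^- m makes this family stable under differentiation. *)
Definition flat (m : nat) (t : R) : R :=
  if 0 < t then (t ^+ m)^-1 * expR (- t^-1) else 0.

(** The exponential series bounds exp (1/t) from below by the term of degree
m + 1, which beats t ^- m by one power of t. *)
Lemma flat_le m (t : R) : `|flat m t| <= (m.+1)`!%:R * `|t|.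
Proof.
rewrite /flat; case: ifP => [t0|_]; last by rewrite normr0 mulr_ge0.
have V0 : 0 <= t^-1 by rewrite invr_ge0 ltW.
have := expR_ge1Dxn m V0; rewrite expRN.
set E := expR t^-1 => hE.
have E0 : 0 < E by exact: expR_gt0.
have tm0 : 0 < t ^+ m by rewrite exprn_gt0.
rewrite (gtr0_norm t0) ger0_norm; last by rewrite mulr_ge0 // invr_ge0 ltW.
have f0 : 0 < ((m.+1)`!%:R : R) by rewrite ltr0n fact_gt0.
have {}hE : t^-1 ^+ m.+1 / (m.+1)`!%:R <= E.
  by apply: le_trans hE; rewrite lerDr.
rewrite -invfM -div1r ler_pdivrMr ?mulr_gt0 //.
have c0 : 0 <= (m.+1)`!%:R * t * t ^+ m by rewrite !mulr_ge0 // ltW.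
rewrite mulrA; apply: le_trans (ler_wpM2l c0 hE).
rewrite le_eqVlt; apply/orP; left; apply/eqP; rewrite exprVn exprS.
by field; rewrite !gt_eqF.
Qed.

(** At 0 the difference quotient of flat m is flat m.+1, which tends to 0. *)
Lemma is_derive_flat m (t : R) :
  is_derive t 1 (flat m) (flat m.+2 t - m%:R * flat m.+1 t).
Proof.
have [t0|t0|<-] := ltgtP 0 t; last first.
- rewrite {2 3}/flat ltxx mulr0 subr0; apply: is_derive_cvg.
  apply: (@cvg_near_eq _ _ _ _ _ (flat m.+1)).
    near=> h; rewrite addr0 [_%:A]mulr1 {2}/flat ltxx subr0 /flat.
    by case: ifP => _; rewrite ?mulr0 // exprS invfM mulrA.
  apply: cvg_within_filter; apply/cvgr0Pnorm_lt => e e0.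
  have eC : 0 < e / (m.+2)`!%:R by rewrite divr_gt0 ?ltr0n ?fact_gt0.
  have small := @pseudometric_normed_Zmodule.nbhs0_lt R R _ eC.
  near=> h; apply: le_lt_trans (flat_le m.+1 h) _.
  by rewrite mulrC -ltr_pdivlMr ?ltr0n ?fact_gt0 //; near: h; exact: small.
- have ft s : flat s t = 0 by rewrite /flat lt_gtF.
  rewrite !ft // mulr0 subr0.
  have dc : is_derive t 1 (cst 0 : R -> R) 0 by exact: is_derive_cst.
  apply: near_eq_is_derive dc.
  near=> s; rewrite /flat lt_gtF //; near: s; exact: lt_nbhsl.
suff df : is_derive t 1 (fun s : R => (s ^+ m)^-1 * expR (- s^-1))
    (flat m.+2 t - m%:R * flat m.+1 t).
  refine (near_eq_is_derive _ df).
  by near=> s; rewrite /flat ifT //; near: s; exact: lt_nbhsr.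
have tn0 : t != 0 by rewrite gt_eqF.
have dX : is_derive t 1 (fun s : R => s ^+ m) (m%:R * t ^+ m.-1).
  apply: DeriveDef; first exact: exprn_derivable.
  by rewrite exp_derive /GRing.scale /= mulr1.
have dV : is_derive t 1 (fun s : R => s^-1) (- t ^- 2).
  by rewrite -[X in is_derive _ _ _ X]mulr1; apply: is_deriveV.
have dE : is_derive t 1 (fun s : R => expR (- s^-1)) (expR (- t^-1) * t ^- 2).
  have dN : is_derive t 1 (fun s : R => - s^-1) (t ^- 2).
    by rewrite -[t ^- 2]opprK; apply: is_deriveN.
  exact: (@is_derive1_comp _ expR _ t).
have dXV : is_derive t 1 (fun s : R => (s ^+ m)^-1)
    (- (t ^+ m) ^- 2 *: (m%:R * t ^+ m.-1)).
  by apply: (@is_deriveV _ (fun s => s ^+ m)) => //; exact: expf_neq0.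
refine (is_derive_eq (is_deriveM dXV dE) _); rewrite /flat t0 /GRing.scale /=.
clear dX dXV; case: m => [|m] /=; first by field.
have um0 : t ^+ m != 0 by exact: expf_neq0.
rewrite !exprS; set u := t ^+ m in um0 *; set c := m.+1%:R; set e := expR _.
by field; rewrite tn0 um0.
Unshelve. all: by end_near. Qed.

End Flat.

Section Bump.
Variables (R : realType) (n : nat).
Implicit Types (a y : 'rV[R]_n).

Lemma is_derive_comp1 (phi : R -> R) (u : 'rV[R]_n -> R) y v (du dphi : R) :
  is_derive y v u du -> is_derive (u y) 1 phi dphi ->
  is_derive y v (phi \o u) (dphi * du).
Proof.
move=> /is_derive_line hu hphi; apply/is_derive_line.
apply: (@is_derive1_comp _ phi (fun t => u (y + t *: v))) => //.
by rewrite scale0r addr0.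
Qed.

Lemma Ck_flat k (U : set 'rV[R]_n) m (j : 'I_n) (c s : R) : open U ->
  Ck k U (fun y => flat m (c + s * y 0 j)).
Proof.
move=> oU.
have du v y : is_derive y v (fun y : 'rV[R]_n => c + s * y 0 j) (s * v 0 j).
  rewrite -[s * v 0 j]add0r.
  exact: (is_deriveD (is_derive_cst c y v) (is_deriveZ s (derive_coord v y j))).
have df p v y := is_derive_comp1 (du v y) (is_derive_flat p (c + s * y 0 j)).
have cf p : continuous (fun y : 'rV[R]_n => flat p (c + s * y 0 j)).
  move=> y; apply: (@continuous_comp _ _ _ (fun y : 'rV[R]_n => c + s * y 0 j)).
    exact: (Ck_continuous (CkD openT (Ck_cst 0 setT c)
      (CkM openT (Ck_cst 0 setT s) (Ck_coord 0 setT j))) Logic.I).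
  exact: is_derive1_continuous (is_derive_flat p _).
elim: k m => [|k IH] m; first by split=> // x _; exact: cf.
split=> [x _|i]; first exact: cf.
split=> [x _|]; first by have [] := df m 'e_i x.
rewrite (_ : (fun _ => _) = (fun y => flat m.+2 (c + s * y 0 j)) *
    cst (s * ('e_i : 'rV[R]_n) 0 j) + (fun y => flat m.+1 (c + s * y 0 j)) *
    cst (- m%:R * (s * ('e_i : 'rV[R]_n) 0 j))).
  by apply: CkD => //; apply: CkM => //; exact: Ck_cst.
apply/funext => y; have [_ ->] := df m 'e_i y; rewrite !fctE /=; ring.
Qed.

Lemma Ck_prod k (U : set 'rV[R]_n) (I : Type) (s : seq I)
    (F : I -> 'rV[R]_n -> R) : open U ->
  (forall i, Ck k U (F i)) -> Ck k U (fun y => \prod_(i <- s) F i y).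
Proof.
move=> oU hF; elim: s => [|i s IH].
  rewrite (_ : (fun _ => _) = cst 1); first exact: Ck_cst.
  by apply/funext => y; rewrite big_nil.
rewrite (_ : (fun _ => _) = F i * (fun y => \prod_(i <- s) F i y)).
  exact: CkM.
by apply/funext => y; rewrite big_cons.
Qed.

Lemma smooth_bump a (r : R) : 0 < r -> exists b : 'rV[R]_n -> R,
  [/\ Cinfty_on setT b, b a != 0 & forall y, b y != 0 -> ball a r y].
Proof.
move=> r0.
pose f (j : 'I_n) := (fun y : 'rV[R]_n => flat 0 ((r + a 0 j) + (-1) * y 0 j)) *
                     (fun y : 'rV[R]_n => flat 0 ((r - a 0 j) + 1 * y 0 j)).
have flat0 (t : R) : (flat 0 t != 0) = (0 < t).
  by rewrite /flat; case: ifP => //; rewrite ?eqxx // expr0 invr1 mul1r gt_eqF ?expR_gt0.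
exists (fun y => \prod_j f j y); split.
- move=> k; apply: Ck_prod => [|j]; first exact: openT.
  by apply: CkM; [exact: openT| |]; apply: Ck_flat; exact: openT.
- apply/prodf_neq0 => j _; rewrite /f !fctE mulf_neq0 // flat0; lra.
- move=> y /prodf_neq0 H; apply/ball_rV; split=> // j.
  have := H j isT; rewrite /f !fctE mulf_eq0 negb_or !flat0 => /andP[h1 h2].
  by rewrite ltr_norml; apply/andP; split; lra.
Qed.

End Bump.

(** * Monotone implicit functions of one variable *)

Section Implicit.
Variable R : realType.

(** Continuity of G in each variable separately suffices: the signs of G at
heights just above and below u t persist nearby, and by monotonicity the root is
trapped between these heights. *)
Lemma monotone_implicit (G : R -> R -> R) (r : R) : 0 < r ->
  (forall t s, `|t| < r -> `|s| < r -> {for t, continuous (G ^~ s)}) ->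
  (forall t s, `|t| < r -> `|s| < r -> {for s, continuous (G t)}) ->
  (forall t s s', `|t| < r -> `|s| < r -> `|s'| < r -> s < s' ->
    G t s < G t s') ->
  G 0 0 = 0 ->
  exists (d : R) (u : R -> R), [/\ 0 < d, u 0 = 0 & forall t, `|t| < d ->
    [/\ `|u t| < r, G t (u t) = 0 & {for t, continuous u}]].
Proof.
move=> r0 c1 c2 mono G00.
have n0 : `|0 : R| < r by rewrite normr0.
pose q := r / 2.
have q0 : 0 < q by rewrite divr_gt0.
have qr : `|q| < r by rewrite gtr0_norm // /q; lra.
have Nqr : `|- q| < r by rewrite normrN.
(* G t changes sign on [- q, q] for all small t. *)
have Gq : \forall t \near (0 : R), [/\ `|t| < r, G t (- q) < 0 & 0 < G t q].
  have h1 : G 0 (- q) < 0 by rewrite -[ltRHS]G00 mono // oppr_lt0.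
  have h2 : 0 < G 0 q by rewrite -[ltLHS]G00 mono.
  have k1 : \forall t \near (0 : R), G t (- q) < 0.
    by apply: (cvgr_lt _ (c1 0 (- q) n0 Nqr)).
  have k2 : \forall t \near (0 : R), 0 < G t q.
    by apply: (cvgr_gt _ (c1 0 q n0 qr)).
  have k3 := @pseudometric_normed_Zmodule.nbhs0_lt R R _ r0.
  by near=> t; split; near: t.
have [d /= d0 Hd] : exists2 d : R, 0 < d & forall t, `|t| < d ->
    [/\ `|t| < r, G t (- q) < 0 & 0 < G t q].
  move/nbhs_ballP: Gq => [d /= d0 Hd]; exists d => // t td; apply: Hd.
  by rewrite /ball /= sub0r normrN.
(* The premise |t| < d sits inside, so that choice applies to all t. *)
have root t : exists s, `|t| < d -> `|s| < r /\ G t s = 0.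
  case: (ltP `|t| d) => td; last by exists 0.
  have [tr gN gP] := Hd t td.
  have qq : - q <= q by rewrite ge0_cp // ltW.
  have cG : {within `[- q, q], continuous (G t)}.
    apply: continuous_in_subspaceT => s.
    rewrite inE /= in_itv /= /q => /andP[s1 s2].
    by apply: c2 => //; rewrite ltr_norml; apply/andP; split; lra.
  have Gminmax : Num.min (G t (- q)) (G t q) <= 0 <= Num.max (G t (- q)) (G t q).
    by rewrite ge_min le_max (ltW gN) (ltW gP) orbT.
  have [s sq Gs] := IVT qq cG Gminmax.
  exists s => _; split=> //; move: sq; rewrite in_itv /= => /andP[s1 s2].
  by rewrite ltr_norml; apply/andP; split; rewrite /q in s1 s2; lra.
have [u Hu] := choice root.
have u0 : u 0 = 0.
  have [|ur Gu] := Hu 0; first by rewrite normr0.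
  case: (ltgtP (u 0) 0) => // h.
    by have := mono 0 (u 0) 0 n0 ur n0 h; rewrite Gu G00 ltxx.
  by have := mono 0 0 (u 0) n0 n0 ur h; rewrite Gu G00 ltxx.
exists d, u; split=> // t td; have [ur Gu] := Hu t td; split=> //.
have [tr _ _] := Hd t td.
apply: continuous_dist => e e0.
(* e' is small enough for u t - e' and u t + e' to stay in the box. *)
pose e' := Num.min e ((r - `|u t|) / 2).
have e'0 : 0 < e' by rewrite lt_min e0 divr_gt0 // subr_gt0.
have e'e : e' <= e by rewrite ge_min lexx.
have e'r : e' <= (r - `|u t|) / 2 by rewrite ge_min lexx orbT.
have [ut1 ut2] : - `|u t| <= u t /\ u t <= `|u t|.
  by rewrite ler_norm lerNl -normrN ler_norm.
have hm : `|u t - e'| < r by rewrite ltr_norml; apply/andP; split; lra.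
have hp : `|u t + e'| < r by rewrite ltr_norml; apply/andP; split; lra.
have k1 : \forall s \near t, G s (u t - e') < 0.
  apply: (cvgr_lt _ (c1 t _ tr hm)); rewrite -[ltRHS]Gu mono //; lra.
have k2 : \forall s \near t, 0 < G s (u t + e').
  apply: (cvgr_gt _ (c1 t _ tr hp)); rewrite -[ltLHS]Gu mono //; lra.
have k3 : \forall s \near t, `|s| < d.
  by apply: (cvgr_lt _ (@norm_continuous _ _ t)).
near=> s.
have sd : `|s| < d by near: s.
have g1 : G s (u t - e') < 0 by near: s.
have g2 : 0 < G s (u t + e') by near: s.
have [sr _ _] := Hd s sd; have [us Gus] := Hu s sd.
have l1 : u t - e' < u s.
  rewrite ltNge; apply/negP; rewrite le_eqVlt => /predU1P[E|l].
    by move: g1; rewrite -E Gus ltxx.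
  by have := lt_trans (mono s _ _ sr us hm l) g1; rewrite Gus ltxx.
have l2 : u s < u t + e'.
  rewrite ltNge; apply/negP; rewrite le_eqVlt => /predU1P[E|l].
    by move: g2; rewrite E Gus ltxx.
  by have := lt_trans g2 (mono s _ _ sr hp us l); rewrite Gus ltxx.
rewrite ler_norml; apply/andP; split; lra.
Unshelve. all: by end_near. Qed.

Lemma derive_zero_cst (f : R -> R) (d : R) :
  (forall t : R, `|t| < d -> is_derive t 1 f 0) ->
  forall t, `|t| < d -> f t = f 0.
Proof.
move=> df t td.
have sub (a b s : R) : `|a| < d -> `|b| < d -> s \in `[a, b] -> `|s| < d.
  rewrite !ltr_norml in_itv /= => /andP[a1 a2] /andP[b1 b2] /andP[s1 s2].
  by apply/andP; split; [exact: lt_le_trans s1|exact: le_lt_trans b2].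
have n0 : `|0 : R| < d by rewrite normr0 (le_lt_trans _ td).
have const a b : `|a| < d -> `|b| < d -> a <= b -> f a = f b.
  move=> ad bd ab.
  have [||c _] := @MVT_segment R f (fun=> 0) a b ab.
  - by move=> s /subset_itv_oo_cc sab; apply: df; exact: sub sab.
  - apply: continuous_in_subspaceT => s; rewrite inE => sab.
    exact: is_derive1_continuous (df s (sub _ _ _ ad bd sab)).
  by rewrite mul0r => /eqP; rewrite subr_eq0 => /eqP.
by case: (leP t 0) => [t0|/ltW t0]; [exact: const|apply/esym; exact: const].
Qed.

End Implicit.

(** * Tangent vectors in local coordinates *)

Section TangentVectors.
Variables (R : realType) (X : dspace R).

Lemma CinfBE (f g : Cinf X) q : (f - g) q = f q - g q. Proof. by []. Qed.
Lemma CinfME (f g : Cinf X) q : (f * g) q = f q * g q. Proof. by []. Qed.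
Lemma CinfZE (c : R) (f : Cinf X) q : (c *: f) q = c * f q. Proof. by []. Qed.

Section Algebra.
Variables (p : X) (w : Cinf X -> R).
Hypothesis tw : tangent_vector p w.

Lemma tangent_vectorD f g : w (f + g) = w f + w g.
Proof. by have := tw.1 1 f g; rewrite scale1r mul1r. Qed.

Lemma tangent_vector0 : w 0 = 0.
Proof. by apply: (addrI (w 0)); rewrite -tangent_vectorD !addr0. Qed.

Lemma tangent_vectorZ (c : R) f : w (c *: f) = c * w f.
Proof. by have := tw.1 c f 0; rewrite !addr0 tangent_vector0 addr0. Qed.

Lemma tangent_vectorB f g : w (f - g) = w f - w g.
Proof. by rewrite tangent_vectorD -[- g]scaleN1r tangent_vectorZ mulN1r. Qed.

Lemma tangent_vector_sum I (s : seq I) (F : I -> Cinf X) :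
  w (\sum_(i <- s) F i) = \sum_(i <- s) w (F i).
Proof. exact: (big_morph w tangent_vectorD tangent_vector0). Qed.

Lemma tangent_vector_cst (c : R) : w (c *: (1 : Cinf X)) = 0.
Proof.
rewrite tangent_vectorZ; suff -> : w 1 = 0 by rewrite mulr0.
have one_p : (1 : Cinf X) p = 1 by [].
have := tw.2 1 1; rewrite mulr1 one_p mulr1 mul1r => E.
by apply: (addrI (w 1)); rewrite addr0 -E.
Qed.

End Algebra.

Lemma vfield_tangent_vector (D : vfield X) (p : X) :
  tangent_vector p (fun f => D f p).
Proof.
have [lD mD] := vfieldP D; split=> [c f g|f g]; first by rewrite lD.
by rewrite mD.
Qed.

Section Chart.
Variables (n : nat) (c : chart X n).
Hypothesis hc : is_chart c.

Lemma near_cdom p : cdom c p -> \forall q \near p, cdom c q.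
Proof.
by case: hc => -[oU _] _ _ _ _ cp; apply: (open_near oU cp) => q.
Qed.

Lemma near_coord p (P : 'rV[R]_n -> Prop) : cdom c p ->
  (\forall y \near coord c p, P y) -> \forall q \near p, P (coord c q).
Proof. by case: hc => _ cc _ _ _ cp; exact: (cc p cp). Qed.

Lemma near_param p (P : X -> Prop) : cdom c p ->
  (\forall q \near p, P q) -> \forall y \near coord c p, P (param c y).
Proof.
case: hc => _ _ cpm pmK _ cp nP; have := cpm p cp; rewrite /prop_for.
by rewrite /continuous_at pmK // => h; exact: (h _ nP).
Qed.

Lemma near_coordK p : cdom c p ->
  \forall y \near coord c p, cdom c (param c y) /\ coord c (param c y) = y.
Proof.
case: hc => -[_ oV] _ _ pmK _ cp.
apply: (open_near oV); first by exists p.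
by move=> _ [q cq <-]; rewrite pmK.
Qed.

Lemma chart_smooth p (h : Cinf X) : cdom c p ->
  Cinfty_at (coord c p) (h \o param c).
Proof.
case: hc => _ _ _ _ sm cp; apply/sm => //.
by exists h; exact: filterE.
Qed.

(** The chart condition compares germs in the chart with germs of elements of
Cinf X, so that a germ in coordinates extends to all of X. *)
Lemma chart_lift p (K : 'rV[R]_n -> R) : cdom c p ->
  Cinfty_at (coord c p) K -> exists k : Cinf X, \forall q \near p, K (coord c q) = k q.
Proof.
move=> cp hK; have [_ _ _ _ /(_ p cp (K \o coord c)) [_ sm]] := hc; apply: sm.
apply: eq_Cinfty_at hK.
have H := near_coordK cp.
near=> y; have [_ yK] : cdom c (param c y) /\ coord c (param c y) = y by near: y.
by rewrite /= yK.
Unshelve. all: by end_near. Qed.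

Lemma Cinf_continuous_at p (h : Cinf X) : cdom c p -> {for p, continuous h}.
Proof.
move=> cp; have [_ cc _ pmK _] := hc.
apply: (@near_eq_continuous _ _ ((h \o param c) \o coord c)).
  have H := near_cdom cp.
  by near=> q; rewrite /= pmK //; near: q.
apply: continuous_comp; first exact: cc.
exact: Cinfty_at_continuous (chart_smooth h cp).
Unshelve. all: by end_near. Qed.

End Chart.

Section Manifold.
Variable n : nat.
Hypothesis mX : manifold X n.

Lemma Cinf_continuous (h : Cinf X) : continuous h.
Proof.
move=> p; have [_ _ /(_ p)[c hc cp] _] := mX.
exact: Cinf_continuous_at hc _ h cp.
Qed.

(** The bump function of a small ball in a chart, extended by 0. The extension is
smooth because the support is compact, hence closed as X is Hausdorff. *)
Lemma manifold_bump (p : X) (U : set X) : nbhs p U ->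
  exists B : Cinf X, B p != 0 /\ forall q, B q != 0 -> U q.
Proof.
move=> nU; have [hX _ /(_ p)[c hc cp] loc] := mX.
have [_ _ cpm pmK _] := hc.
have : \forall y \near coord c p,
    (cdom c (param c y) /\ coord c (param c y) = y) /\ U (param c y).
  have H1 := near_coordK hc cp; have H2 := near_param hc cp nU.
  by near=> y; split; near: y.
move=> /nbhs_ballP[r /= r0 Br].
have r20 : 0 < r / 2 by rewrite divr_gt0.
have [b [sb ba bB]] := smooth_bump (coord c p) r20.
pose B (q : X) : R := if pselect (cdom c q) then b (coord c q) else 0.
have BE q : cdom c q -> B q = b (coord c q) by rewrite /B; case: pselect.
have BN q : ~ cdom c q -> B q = 0 by rewrite /B; case: pselect.
(* K is a compact cube between the ball of radius r / 2, where b lives, and the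
   ball of radius r, which is contained in the chart. *)
pose K := [set v : 'rV[R]_n | forall i : 'I_n,
  `[coord c p 0 i - r / 2, coord c p 0 i + r / 2]%classic (v 0 i)].
have KB : K `<=` ball (coord c p) r.
  move=> v Kv; apply/ball_rV; split=> // j.
  have := Kv j; rewrite /= in_itv /= => /andP[h1 h2].
  by rewrite ltr_norml; apply/andP; split; lra.
have BK : ball (coord c p) (r / 2) `<=` K.
  move=> v /ball_rV[_ Bv] j; have := Bv j; rewrite ltr_norml => /andP[h1 h2].
  by rewrite /= in_itv /=; apply/andP; split; lra.
have cK : compact K.
  by apply: (@rV_compact _ _ (fun i : 'I_n =>
    `[coord c p 0 i - r / 2, coord c p 0 i + r / 2]%classic)) => i;
    exact: segment_compact.
have closedK : closed (param c @` K).
  apply: compact_closed => //; apply: continuous_compact => //.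
  apply: continuous_in_subspaceT => v; rewrite inE => Kv.
  by have [[cv <-] _] := Br v (KB v Kv); exact: cpm.
have sB : smooth B.
  apply: loc => q; case: (pselect (cdom c q)) => cq.
    have [|k kE] := chart_lift hc cq (K := b).
      by exists setT; split=> //; exact: openT.
    exists k; have H := near_cdom hc cq.
    near=> q'; rewrite BE; first by near: q'.
    by near: q'.
  exists 0; apply: (@open_near _ (~` (param c @` K))).
  - exact: closed_openC.
  - by case=> v Kv E; apply: cq; rewrite -E; have [[]] := Br v (KB v Kv).
  move=> q' nK; rewrite /B; case: pselect => // cq'.
  case: (eqVneq (b (coord c q')) 0) => // /bB Bq'.
  by exfalso; apply: nK; exists (coord c q'); [exact: BK|exact: pmK].
exists (MkCinf (asboolT sB : B \in @smooth_pred R X)); split=> [|q].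
  by change (is_true (B p != 0)); rewrite BE.
change (is_true (B q != 0) -> U q); case: (pselect (cdom c q)) => cq; last first.
  by rewrite BN // eqxx.
rewrite BE // => /bB Bq; have [_] := Br _ (KB _ (BK _ Bq)).
by rewrite pmK.
Unshelve. all: by end_near. Qed.

(** If B is a bump function at p supported where f vanishes, then f B = 0, and
the Leibniz rule leaves w f * B p = 0. *)
Lemma tangent_vector_local (p : X) (w : Cinf X -> R) (f : Cinf X) :
  tangent_vector p w -> (\forall q \near p, f q = 0) -> w f = 0.
Proof.
move=> tw f0; have [B [Bp BU]] := manifold_bump f0.
have fB : f * B = 0.
  apply/val_inj/funext => q /=; rewrite !fctE /=.
  by case: (eqVneq (B q) 0) => [->|/BU ->]; rewrite ?mulr0 ?mul0r.
have := tw.2 f B; rewrite fB (tangent_vector0 tw) (nbhs_singleton f0) mul0r addr0.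
by move/esym/eqP; rewrite mulf_eq0 (negPf Bp) orbF => /eqP.
Qed.

Lemma eq_tangent_vector (p : X) (w : Cinf X -> R) (f g : Cinf X) :
  tangent_vector p w -> (\forall q \near p, f q = g q) -> w f = w g.
Proof.
move=> tw fg; apply/eqP; rewrite -subr_eq0 -(tangent_vectorB tw); apply/eqP.
apply: (tangent_vector_local tw).
by apply: filterS fg => q fgq; rewrite CinfBE fgq subrr.
Qed.

(** Near p, h is h p + sum_i (x_i - x_i p) k_i by the lemma of Hadamard; the
Leibniz rule kills everything but w (x_i) * k_i p. The functions x are global
extensions of the germs of the coordinates, since w acts on global functions
only. *)
Lemma tangent_vector_partials (c : chart X n) (x : 'I_n -> Cinf X) (p : X)
    (w : Cinf X -> R) (h : Cinf X) : is_chart c -> cdom c p ->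
  (forall i, \forall q \near p, coord c q 0 i = x i q) -> tangent_vector p w ->
  w h = \sum_i w (x i) * 'D_('e_i) (h \o param c) (coord c p).
Proof.
move=> hc cp xE tw; have [_ _ cpm pmK _] := hc.
have [r [K [r0 _ hK hE KD]]] := Cinfty_at_hadamard (chart_smooth hc h cp).
have Ba : ball (coord c p) r (coord c p) by exact: ballxx.
have /choice[k kE] : forall i, exists k : Cinf X,
    \forall q \near p, K i (coord c q) = k q.
  by move=> i; apply: chart_lift => //; exact: Cinfty_on_ball_at (hK i) Ba.
pose g : Cinf X := h p *: (1 : Cinf X) +
    \sum_i (x i - x i p *: (1 : Cinf X)) * k i.
have CsumE (F : 'I_n -> Cinf X) q : (\sum_i F i : Cinf X) q = \sum_i F i q.
  by apply: (big_morph (fun f : Cinf X => f q)).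
have hg : \forall q \near p, h q = g q.
  have H1 := near_cdom hc cp.
  have H2 : \forall q \near p, ball (coord c p) r (coord c q).
    apply: (near_coord hc (P := ball (coord c p) r)) => //; exact: nbhsx_ballx.
  have H3 : \forall q \near p, forall i, coord c q 0 i = x i q.
    exact: filter_forall.
  have H4 : \forall q \near p, forall i, K i (coord c q) = k i q.
    exact: filter_forall.
  near=> q.
  have cq : cdom c q by near: q.
  have xq : forall i, coord c q 0 i = x i q by near: q.
  have kq : forall i, K i (coord c q) = k i q by near: q.
  have hq : ball (coord c p) r (coord c q) by near: q.
  have := hE _ hq; rewrite /= !pmK // => ->.
  rewrite /g -[RHS]/(h p * 1 + (\sum_i (x i - x i p *: (1 : Cinf X)) * k i : Cinf X) q).
  rewrite CsumE mulr1; congr (_ + _).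
  apply: eq_bigr => i _; rewrite CinfME CinfBE CinfZE mulr1.
  by rewrite xq kq (nbhs_singleton (xE i)).
rewrite (eq_tangent_vector tw hg) /g (tangent_vectorD tw).
rewrite (tangent_vector_cst tw) add0r (tangent_vector_sum tw).
apply: eq_bigr => i _; rewrite tw.2 (tangent_vectorB tw) (tangent_vector_cst tw).
rewrite subr0 -(nbhs_singleton (kE i)) KD -[RHS]addr0; congr (_ + _).
by rewrite CinfBE CinfZE mulr1 subrr mul0r.
Unshelve. all: by end_near. Qed.

Lemma partial_tangent_vector (c : chart X n) (p : X) i : is_chart c -> cdom c p ->
  tangent_vector p (fun h : Cinf X => 'D_('e_i) (h \o param c) (coord c p)).
Proof.
move=> hc cp; have [_ _ _ pmK _] := hc.
have d (h : Cinf X) : derivable (h \o param c) (coord c p) 'e_i.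
  exact: Cinfty_at_derivable (chart_smooth hc h cp).
split=> [k f g|f g].
  rewrite (_ : (k *: f + g : Cinf X) \o param c =
    k \*: (f \o param c) + (g \o param c)) //.
  by rewrite deriveD ?deriveZ //; exact: derivableZ.
rewrite (_ : (f * g : Cinf X) \o param c = (f \o param c) * (g \o param c)) //.
by rewrite deriveM // /= pmK // /GRing.scale /= addrC mulrC.
Qed.

Lemma chart_coordinates (c : chart X n) p : is_chart c -> cdom c p ->
  exists x : 'I_n -> Cinf X,
    forall i, \forall q \near p, coord c q 0 i = x i q.
Proof.
move=> hc cp.
have /choice[x xE] : forall i, exists k : Cinf X,
    \forall q \near p, coord c q 0 i = k q.
  move=> i; apply: (chart_lift hc cp (K := fun y => y 0 i)).
  by exists setT; split=> [||k]; [exact: openT| |exact: Ck_coord].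
by exists x.
Qed.

Lemma critical_partials (c : chart X n) p (f : Cinf X) : is_chart c -> cdom c p ->
  critical f p <-> forall i, 'D_('e_i) (f \o param c) (coord c p) = 0.
Proof.
move=> hc cp; split=> [cf i|df w tw].
  exact: (cf _ (partial_tangent_vector i hc cp)).
have [x xE] := chart_coordinates hc cp.
rewrite (tangent_vector_partials f hc cp xE tw) big1 // => i _.
by rewrite df mulr0.
Qed.

End Manifold.
End TangentVectors.

(** * Curves following a field inside a level set *)

Lemma continuous_fsum (R : realType) (T : topologicalType) n (F : 'I_n -> T -> R)
    y : (forall i, {for y, continuous (F i)}) ->
  {for y, continuous (fun z => \sum_i F i z)}.
Proof.
move=> cF; rewrite (_ : (fun _ => _) = \sum_i F i); last first.
  by apply/funext => z; rewrite fct_sumE.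
elim/big_ind: _ => [|G H cG cH|i _]; last exact: cF.
  exact: cst_continuous.
exact: continuousD.
Qed.

Section Curves.
Variables (R : realType) (X : dspace R) (n : nat).
Hypothesis mX : manifold X n.
Variables (f : Cinf X) (D : vfield X).
Hypothesis Df0 : D f = 0.

(** A substitute for the integral curve of D through p: only the velocity at time
0 matters, which avoids solving a differential equation. *)
Definition first_order_curve (p : X) (d : R) (g : R -> X) : Prop :=
  [/\ 0 < d, g 0 = p,
      forall t, `|t| < d -> [/\ {for t, continuous g}, f (g t) = f p
        & critical f (g t) <-> critical f p]
    & forall h : Cinf X, is_derive (0 : R) 1 (h \o g) (D h p)].

Section Chart.
Variables (c : chart X n) (p : X) (x : 'I_n -> Cinf X).
Hypotheses (hc : is_chart c) (cp : cdom c p).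
Hypothesis xE : forall i, \forall q \near p, coord c q 0 i = x i q.

Let a := coord c p.
Let F := f \o param c.
Let w : 'rV[R]_n := \row_i D (x i) p.

Lemma curve_velocity (g : R -> 'rV[R]_n) : g 0 = a ->
  (forall i, is_derive (0 : R) 1 (fun t => g t 0 i) (D (x i) p)) ->
  forall h : Cinf X, is_derive (0 : R) 1 (h \o (param c \o g)) (D h p).
Proof.
move=> g0 dg h.
rewrite (tangent_vector_partials mX h hc cp xE (vfield_tangent_vector D p)).
exact: (is_derive_curve (chart_smooth hc h cp) g0 dg).
Qed.

Lemma near_curve (P : 'rV[R]_n -> Prop) (g : R -> 'rV[R]_n) :
  {for 0, continuous g} -> (\forall y \near g 0, P y) ->
  exists2 d : R, 0 < d & forall t, `|t| < d -> P (g t).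
Proof.
move=> cg nP; have /nbhs_ballP[d /= d0 Hd] := cg _ nP.
exists d => // t td; apply: Hd.
by rewrite /ball /= sub0r normrN.
Qed.

(** The equation D f = 0 in coordinates holds on a whole neighbourhood, because
the functions x agree with the coordinates near every point close to p. It can
therefore be differentiated. *)
Lemma local_vfield_partials : \forall y \near a,
  \sum_i D (x i) (param c y) * 'D_('e_i) F y = 0.
Proof.
have H1 := near_coordK hc cp.
have H2 : \forall q \near p, forall i, \forall q' \near q, coord c q' 0 i = x i q'.
  by apply: filter_forall => i; exact: nbhs_interior (xE i).
have H3 := near_param hc cp H2.
near=> y.
have [cy yK] : cdom c (param c y) /\ coord c (param c y) = y by near: y.
have xy : forall i, \forall q' \near param c y, coord c q' 0 i = x i q'.
  by near: y.
have := tangent_vector_partials mX f hc cy xy (vfield_tangent_vector D (param c y)).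
by rewrite /= Df0 yK => <-.
Unshelve. all: by end_near. Qed.

Let smooth_F : Cinfty_at a F.
Proof. exact: chart_smooth. Qed.

(** The derivative at p of the equation sum_j D x_j * D_j f = 0 along the i-th
axis; the terms with a first derivative of f vanish at a critical point. *)
Lemma hessian_kernel : critical f p -> forall i,
  \sum_j D (x j) p * 'D_('e_i) ('D_('e_j) F) a = 0.
Proof.
move=> /(critical_partials mX f hc cp) crit i.
have der : is_derive a 'e_i (\sum_(j < n) (fun y => D (x j) (param c y)) *
    'D_('e_j) F) (\sum_j (D (x j) p * 'D_('e_i) ('D_('e_j) F) a)).
  apply: is_derive_sum => j.
  rewrite -[X in is_derive _ _ _ X]addr0.
  have -> : D (x j) p * 'D_('e_i) ('D_('e_j) F) a + 0 =
    (fun y => D (x j) (param c y)) a *: 'D_('e_i) ('D_('e_j) F) a +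
    'D_('e_j) F a *: 'D_('e_i) (fun y => D (x j) (param c y)) a.
    rewrite crit scale0r /= /GRing.scale /=; congr (D _ _ * _ + _).
    by case: hc => _ _ _ ->.
  apply: is_deriveM; apply: derivableP; apply: Cinfty_at_derivable.
    exact: (chart_smooth hc (D (x j)) cp).
  exact: Cinfty_at_partial.
have near0 : \forall y \near a, (\sum_(j < n) (fun y => D (x j) (param c y)) *
    'D_('e_j) F) y = (cst 0 : 'rV[R]_n -> R) y.
  have H := local_vfield_partials.
  near=> y; rewrite fct_sumE /=; near: y; exact: H.
have [_ <-] := near_eq_is_derive near0 der.
by rewrite derive_cst.
Unshelve. all: by end_near. Qed.

Let near_segment (v : 'rV[R]_n) (P : 'rV[R]_n -> Prop) :
  (\forall y \near a, P y) ->
  exists2 d : R, 0 < d & forall t, `|t| < d -> P (a + t *: v).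
Proof.
move=> nP; apply: (@near_curve P (fun t => a + t *: v)).
  exact: (curve_continuous (is_derive_segment a v 0)).
by rewrite scale0r addr0.
Qed.

Section Slice.
Variable N : {set 'I_n}.
Hypotheses (slice : slice_chart f p c N) (crit : critical f p).

Lemma slice_critical y : cdom c (param c y) -> coord c (param c y) = y ->
  (forall i, i \in N -> y 0 i = a 0 i) -> critical f (param c y).
Proof.
by case: slice => _ _ H cy yK yN; apply/(H _ cy) => i iN; rewrite yK yN.
Qed.

(** D_i f vanishes on the critical set, which contains a segment in the direction
of the j-th axis when j is not in N. *)
Lemma slice_mixed_partial i j : j \notin N -> 'D_('e_j) ('D_('e_i) F) a = 0.
Proof.
move=> jN; have [d d0 Hd] := near_segment 'e_j (near_coordK hc cp).
apply: derive_val; apply/is_derive_line.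
have d0' : is_derive (0 : R) 1 (cst 0 : R -> R) 0 by exact: is_derive_cst.
apply: near_eq_is_derive d0'.
have small := @pseudometric_normed_Zmodule.nbhs0_lt R R _ d0.
near=> t; have td : `|t| < d by near: t; exact: small.
have [cy yK] := Hd t td.
have ct : critical f (param c (a + t *: 'e_j)).
  apply: slice_critical => // l lN; rewrite !mxE eqxx /= (_ : (l == j) = false).
    by rewrite mulr0 addr0.
  by apply/negbTE; apply: contra jN => /eqP <-.
by have := (critical_partials mX f hc cy).1 ct i; rewrite yK => ->.
Unshelve. all: by end_near. Qed.

(** In the equations of [hessian_kernel] with i in N the terms with j outside N
drop out, by the symmetry of the Hessian and [slice_mixed_partial]. What is left
is a linear system whose matrix is the normal Hessian. *)
Lemma normal_velocity0 : nondegenerate f p c N ->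
  forall j, j \in N -> D (x j) p = 0.
Proof.
rewrite /nondegenerate; set M := (\matrix_(_, _) _) => detM.
have uM : M \in unitmx by rewrite unitmxE unitfE.
pose v : 'cV[R]_#|N| := \col_b D (x (enum_val b)) p.
have Mv : M *m v = 0.
  apply/colP => b; rewrite !mxE.
  rewrite -[RHS](hessian_kernel crit (enum_val b)) (bigID (mem N)) /=.
  rewrite [X in _ = _ + X]big1 ?addr0.
    rewrite [RHS]big_enum_val /=; apply: eq_bigr => l _.
    by rewrite !mxE mulrC.
  move=> j jN; rewrite partial_comm; last exact: smooth_F.
  by rewrite slice_mixed_partial // mulr0.
have v0 : v = 0 by rewrite -[v](mulKmx uM) Mv mulmx0.
move=> j jN; have := congr1 (fun u : 'cV_#|N| => u (enum_rank_in jN j) 0) v0.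
by rewrite !mxE enum_rankK_in.
Qed.

(** The curve is a line in the slice chart. It stays in the critical set, on
which f is locally constant, because its velocity has no component along the
coordinates in N. *)
Lemma critical_first_order_curve : nondegenerate f p c N ->
  exists d g, first_order_curve p d g.
Proof.
move=> /normal_velocity0 wN.
have nearP : \forall y \near a,
    (cdom c (param c y) /\ coord c (param c y) = y) /\ Cinfty_at y F.
  have H1 := near_coordK hc cp; have H2 := Cinfty_at_near smooth_F.
  by near=> y; split; near: y; [exact: H1|exact: H2].
have [d d0 Hd] := near_segment w nearP.
have [_ _ cpm pmK _] := hc.
have gcrit t : `|t| < d -> critical f (param c (a + t *: w)).
  move=> /Hd[[cy yK] _]; apply: slice_critical => // i iN.
  by rewrite !mxE wN // mulr0 addr0.
exists d, (param c \o (fun t => a + t *: w)); split=> //.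
- by rewrite /= scale0r addr0; exact: pmK.
- move=> t td; have [[cy yK] _] := Hd t td; split.
  + apply: continuous_comp; first exact: (curve_continuous (is_derive_segment a w t)).
    by rewrite -yK; exact: cpm.
  + have dF (s : R) : `|s| < d -> is_derive s 1 (F \o (fun t => a + t *: w)) 0.
      move=> sd; have [[cs sK] Fs] := Hd s sd.
      have := is_derive_curve Fs (erefl _) (is_derive_segment a w s).
      rewrite big1 // => i _; rewrite -[X in 'D_ _ _ X]sK.
      by rewrite ((critical_partials mX f hc cs).1 (gcrit s sd)) mulr0.
    have := derive_zero_cst dF td; rewrite /F /= scale0r addr0 => ->.
    by rewrite pmK.
  + by split=> _ //; exact: gcrit.
- apply: curve_velocity; first by rewrite scale0r addr0.
  by move=> i; have := is_derive_segment a w 0 i; rewrite mxE.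
Unshelve. all: by end_near. Qed.

End Slice.

(** The line through p with the velocity w of D leaves the level of f only to
second order, because D f p = 0. A correction u t along an axis e on which f is
strictly monotone puts it back into the level, and u has derivative 0 at 0. *)
Lemma regular_first_order_curve : ~ critical f p ->
  exists d g, first_order_curve p d g.
Proof.
move=> ncrit.
have [i0 Di0] : exists i, 'D_('e_i) F a != 0.
  apply: contrapT => H; apply: ncrit; apply/(critical_partials mX f hc cp) => i.
  by apply: contrapT => /eqP Di; apply: H; exists i.
pose e : 'rV[R]_n := 'e_i0; pose sg : R := 'D_e F a.
have Di0P : \forall y \near a, 0 < sg * 'D_e F y.
  have cDF : {for a, continuous (fun y => sg * 'D_e F y)}.
    have := Cinfty_at_continuous (Cinfty_at_partial i0 smooth_F).
    exact: (continuousM (@cst_continuous _ _ sg a)).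
  by apply: (cvgr_gt _ cDF); rewrite -expr2 exprn_even_gt0.
have nearP : \forall y \near a, [/\ cdom c (param c y), coord c (param c y) = y,
    Cinfty_at y F & 0 < sg * 'D_e F y].
  have H1 := near_coordK hc cp; have H2 := Cinfty_at_near smooth_F.
  near=> y.
  have [cy yK] : cdom c (param c y) /\ coord c (param c y) = y by near: y.
  by split=> //; near: y; [exact: H2|exact: Di0P].
have [rho /= rho0 Hrho] := (nbhs_ballP _ _).1 nearP.
(* With |t| and |s| below r = rho / k, the point a + t w + s e stays in the
   ball of radius rho. *)
pose k := `|w| + `|e| + 1.
have k0 : 0 < k by rewrite ltr_wpDl // addr_ge0.
pose r := rho / k.
have r0 : 0 < r by rewrite divr_gt0.
have box t s : `|t| < r -> `|s| < r -> [/\ cdom c (param c (a + t *: w + s *: e)),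
    coord c (param c (a + t *: w + s *: e)) = a + t *: w + s *: e,
    Cinfty_at (a + t *: w + s *: e) F & 0 < sg * 'D_e F (a + t *: w + s *: e)].
  move=> tr sr; apply: Hrho; rewrite -ball_normE /= -addrA opprD addNKr normrN.
  apply: le_lt_trans (ler_normD _ _) _; rewrite !normrZ.
  have rk : rho = r * `|w| + (r * `|e| + r) by rewrite /r /k; field; rewrite gt_eqF.
  rewrite rk ler_ltD ?ler_wpM2r // 1?ltW //.
  apply: (@le_lt_trans _ _ (r * `|e|)); last by rewrite ltrDl.
  by rewrite ler_wpM2r // ltW.
(* The factor sg makes G increasing in s, whatever the sign of the derivative
   of F along e. *)
pose G (t s : R) := sg * (F (a + t *: w + s *: e) - F a).
have dG (t s : R) : `|t| < r -> `|s| < r ->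
    is_derive s 1 (G t) (sg * 'D_e F (a + t *: w + s *: e)).
  move=> tr sr; have [_ _ Fts _] := box t s tr sr.
  have := is_derive_curve Fts (erefl _) (is_derive_segment (a + t *: w) e s).
  rewrite (bigD1 i0) //= mxE !eqxx mul1r big1 ?addr0 => [dF|j ji]; last first.
    by rewrite mxE eqxx (negPf ji) mul0r.
  rewrite -['D_e F _]subr0.
  exact: (is_deriveZ sg (is_deriveB dF (is_derive_cst (F a) s 1))).
have cGt (t s : R) : `|t| < r -> `|s| < r -> {for t, continuous (G ^~ s)}.
  move=> tr sr; have [_ _ Fts _] := box t s tr sr.
  have -> : G ^~ s = cst sg * ((F \o (fun t => (a + s *: e) + t *: w)) - cst (F a)).
    by apply/funext => t'; rewrite /G !fctE /= addrAC.
  apply: continuousM; first exact: cst_continuous.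
  apply: continuousB; last exact: cst_continuous.
  apply: continuous_comp.
    exact: (curve_continuous (is_derive_segment (a + s *: e) w t)).
  by rewrite addrAC; exact: Cinfty_at_continuous.
have monoG (t s s' : R) : `|t| < r -> `|s| < r -> `|s'| < r -> s < s' -> G t s < G t s'.
  move=> tr sr s'r ss'.
  have between (z : R) : z \in `[s, s'] -> `|z| < r.
    move: sr s'r; rewrite !ltr_norml in_itv /= => /andP[h1 h2] /andP[h3 h4].
    by move=> /andP[h5 h6]; apply/andP; split; lra.
  have cG : {within `[s, s'], continuous (G t)}.
    apply: continuous_in_subspaceT => z; rewrite inE => /between zr.
    exact: is_derive1_continuous (dG t z tr zr).
  have [|z zs E] := MVT (f := G t)
    (df := fun s => sg * 'D_e F (a + t *: w + s *: e)) ss' _ cG.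
    by move=> z /subset_itv_oo_cc/between zr; exact: dG.
  have zr := between z (subset_itv_oo_cc zs).
  have [_ _ _ pos] := box t z tr zr.
  by rewrite -subr_gt0 E mulr_gt0 // subr_gt0.
have G00 : G 0 0 = 0 by rewrite /G !scale0r !addr0 subrr mulr0.
have [d [u [d0 u0 Hu]]] := monotone_implicit r0 cGt
  (fun t s tr sr => is_derive1_continuous (dG t s tr sr)) monoG G00.
pose g (t : R) := a + t *: w + u t *: e.
have g0 : g 0 = a by rewrite /g u0 !scale0r !addr0.
have cg t : `|t| < d -> {for t, continuous g}.
  move=> td; have [_ _ cu] := Hu t td.
  apply: continuousD; first exact: (curve_continuous (is_derive_segment a w t)).
  by apply: continuousZl.
have Fg t : `|t| < d -> F (g t) = F a.
  move=> td; have [_ + _] := Hu t td.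
  by move/eqP; rewrite mulf_eq0 (negPf Di0) /= subr_eq0 => /eqP.
have du : is_derive (0 : R) 1 u 0.
  have [rK [K [rK0 _ hK hE KD]]] := Cinfty_at_hadamard smooth_F.
  have n0 : `|0 : R| < d by rewrite normr0.
  have cKg i : {for 0, continuous (K i \o g)}.
    apply: continuous_comp; first exact: cg.
    by rewrite g0; apply: (Ck_continuous (hK i 0%N)); exact: ballxx.
  pose A t := \sum_i w 0 i * K i (g t).
  (* Along g the expansion of F reads 0 = t A t + u t K_i0, so u t / t = q t. *)
  pose q t := - A t * (K i0 (g t))^-1.
  have A0 : A 0 = 0.
    rewrite /A g0; transitivity (D f p); last by rewrite Df0.
    rewrite (tangent_vector_partials mX f hc cp xE (vfield_tangent_vector D p)).
    by apply: eq_bigr => i _; rewrite KD mxE.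
  have K0 : K i0 (g 0) != 0 by rewrite g0 KD.
  have cq : {for 0, continuous q}.
    apply: continuousM; last by apply: continuousV; [exact: K0|exact: cKg].
    apply: continuousN; apply: continuous_fsum => i.
    by apply: continuousM; [exact: cst_continuous|exact: cKg].
  apply: is_derive_cvg; apply: (@cvg_near_eq _ _ _ _ _ q); last first.
    have q0 : q 0 = 0 by rewrite /q A0 oppr0 mul0r.
    move: cq; rewrite /prop_for /continuous_at q0 => cq.
    exact: cvg_within_filter cq.
  have nB : \forall t \near (0 : R), ball a rK (g t).
    by apply: (cg 0 n0); rewrite g0; exact: nbhsx_ballx.
  have nK : \forall t \near (0 : R), K i0 (g t) != 0.
    exact: (cvgr_neq0 _ (cKg i0) K0).
  have nd := @pseudometric_normed_Zmodule.nbhs0_lt R R _ d0.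
  near=> t.
  have t0 : t != 0 by near: t; exact: nbhs_dnbhs_neq.
  have td : `|t| < d by near: t; apply: cvg_within.
  have Kt : K i0 (g t) != 0 by near: t; apply: cvg_within.
  have Bt : ball a rK (g t) by near: t; apply: cvg_within.
  have := hE _ Bt; rewrite Fg // => /esym/eqP; rewrite addrC -subr_eq0 addrK => /eqP.
  have -> : \sum_i (g t 0 i - a 0 i) * K i (g t) = t * A t + u t * K i0 (g t).
    rewrite /A mulr_sumr (bigD1 i0) //= [in RHS](bigD1 i0) //= [RHS]addrAC.
    have gE i : g t 0 i - a 0 i = t * w 0 i + u t * e 0 i.
      by rewrite /g !mxE; ring.
    congr (_ + _).
      by rewrite gE [e 0 i0]mxE !eqxx /=; ring.
    apply: eq_bigr => i ii0.
    by rewrite gE [e 0 i]mxE eqxx (negPf ii0) /=; ring.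
  move=> E; rewrite [_%:A]mulr1 addr0 u0 subr0 /q.
  have -> : A t = - (u t * K i0 (g t)) / t.
    apply: (mulIf t0); rewrite divfK // mulrC.
    by apply/eqP; rewrite -addr_eq0 E.
  by field; rewrite t0 Kt.
have dg i : is_derive (0 : R) 1 (fun t => g t 0 i) (D (x i) p).
  have := is_derive_segment a w 0 i; rewrite [w 0 i]mxE => dw.
  have := is_deriveD dw (is_deriveM du (is_derive_cst (e 0 i) (0 : R) 1)).
  rewrite !scaler0 !addr0; apply: near_eq_is_derive.
  by apply: filterE => t; rewrite /g !fctE /= [in RHS]mxE [in X in _ = _ + X]mxE.
have [_ _ cpm pmK _] := hc.
pose d' := Num.min d r.
have Hd' (t : R) : `|t| < d' -> `|t| < d /\ `|t| < r by rewrite lt_min => /andP.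
exists d', (param c \o g); split.
- by rewrite lt_min d0.
- by rewrite /= g0; exact: pmK.
- move=> t /Hd'[td tr]; have [ur Gu cu] := Hu t td.
  have [cy yK _ pos] := box t (u t) tr ur; rewrite -/(g t) in cy yK pos; split.
  + apply: continuous_comp; last by rewrite -yK; exact: cpm.
    exact: cg.
  + by have := Fg t td; rewrite /F /= pmK.
  + split=> // /(critical_partials mX f hc cy)/(_ i0); rewrite yK => E0.
    by move: pos; rewrite E0 mulr0 ltxx.
- exact: curve_velocity.
Unshelve. all: by end_near. Qed.

End Chart.
End Curves.

(** * Functoriality of Chevalley-Eilenberg cohomology *)

Section Functoriality.
Local Open Scope quotient_scope.

Section Morphism.
Variables (R : comNzRingType) (L C L' C' : lmodType R).
Variables (br : L -> L -> L) (act : L -> {linear C -> C}).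
Variables (br' : L' -> L' -> L') (act' : L' -> {linear C' -> C'}).

(** The pair goes backwards on Lie algebras and forwards on coefficients, as
cochains are contravariant in the former and covariant in the latter. *)
Definition ce_morphism (phi : L' -> L) (psi : C -> C') : Prop :=
  [/\ linear phi, linear psi,
      forall D E, phi (br' D E) = br (phi D) (phi E)
    & forall D c, psi (act (phi D) c) = act' D (psi c)].

Variables (phi : L' -> L) (psi : C -> C').
Hypothesis phi_psi : ce_morphism phi psi.

Definition transport k (a : ('I_k -> L) -> C) : ('I_k -> L') -> C' :=
  fun X => psi (a (phi \o X)).

Let psiZD c u v : psi (c *: u + v) = c *: psi u + psi v.
Proof. by case: phi_psi => _ ->. Qed.

Let psiD u v : psi (u + v) = psi u + psi v.
Proof. by rewrite -[u in LHS]scale1r psiZD scale1r. Qed.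

Let psi0 : psi 0 = 0.
Proof. by apply: (addrI (psi 0)); rewrite -psiD !addr0. Qed.

Let psiZ c u : psi (c *: u) = c *: psi u.
Proof. by rewrite -[c *: u]addr0 psiZD psi0 addr0. Qed.

Lemma transportB k (a b : ('I_k -> L) -> C) :
  transport (a - b) = transport a - transport b.
Proof.
apply/funext => X; rewrite !fctE /transport -scaleN1r addrC psiZD addrC.
by rewrite scaleN1r.
Qed.

Lemma transport_cochain k (a : ('I_k -> L) -> C) :
  cochain a -> cochain (transport a).
Proof.
have [phiL _ _ _] := phi_psi.
have phi_with X i u : phi \o [eta X with i |-> u] =
    [eta (phi \o X) with i |-> phi u] :> ('I_k -> L).
  by apply/funext => j /=; case: ifP.
move=> [la sa]; split=> [X i c u v|X s]; rewrite /transport.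
  by rewrite !phi_with phiL la psiZD.
by rewrite compA sa psiZ.
Qed.

Lemma transport_ce_diff k (a : ('I_k -> L) -> C) :
  ce_diff br' act' (transport a) = transport (ce_diff br act a).
Proof.
have [_ _ phibr psiact] := phi_psi.
have psi_sum I r (P : pred I) (F : I -> C) :
    psi (\sum_(i <- r | P i) F i) = \sum_(i <- r | P i) psi (F i).
  by apply: (big_morph psi psiD psi0).
apply/funext => X; rewrite /ce_diff /transport psiD !psi_sum.
congr (_ + _); apply: eq_bigr => i _; first by rewrite psiZ psiact.
rewrite psi_sum; apply: eq_bigr => j _; rewrite psiZ; congr (_ *: psi (a _)).
by apply/funext => m /=; rewrite /bracket_args /=; case: ifP.
Qed.

Lemma transport_cocycle k (z : cocycles br act k) :
  transport (cocycle_val z) \in @cocycle _ _ _ br' act' k.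
Proof.
case: z => a /= /asboolP[ca za]; apply/asboolP; split.
  exact: transport_cochain.
by rewrite transport_ce_diff za; apply/funext => X; exact: psi0.
Qed.

Definition transport_cocycles k (z : cocycles br act k) :
  cocycles br' act' k := Cocycle (transport_cocycle z).

Lemma transport_cocyclesB k (y z : cocycles br act k) :
  transport_cocycles (y - z) = transport_cocycles y - transport_cocycles z.
Proof. by apply/val_inj; rewrite /= transportB. Qed.

Lemma transport_coboundary k (z : cocycles br act k) :
  z \in @coboundary _ _ _ br act k ->
  transport_cocycles z \in @coboundary _ _ _ br' act' k.
Proof.
move=> /asboolP ez; apply/asboolP => /=.
case: k z ez => [|k] [a aP] /=; first by move=> ->; apply/funext => X; exact: psi0.
move=> [b cb ->]; exists (transport b); first exact: transport_cochain.
by rewrite transport_ce_diff.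
Qed.

Local Notation quotL k := (Quotient.quot (@coboundary _ _ _ br act k)).
Local Notation quotL' k := (Quotient.quot (@coboundary _ _ _ br' act' k)).

Definition ce_map k (x : ce_cohomology br act k) : ce_cohomology br' act' k :=
  \pi_(quotL' k) (transport_cocycles (generic_quotient.repr (x : quotL k))).

Lemma ce_map_pi k (z : cocycles br act k) :
  ce_map (\pi_(quotL k) z) = \pi_(quotL' k) (transport_cocycles z).
Proof.
apply/eqP; rewrite -Quotient.idealrBE -transport_cocyclesB.
by apply: transport_coboundary; rewrite Quotient.idealrBE reprK.
Qed.

Lemma ce_map_is_zmod_morphism k : zmod_morphism (@ce_map k).
Proof.
elim/quotP => y _; elim/quotP => z _; rewrite !ce_map_pi.
rewrite -(raddfB (\pi_(quotL k))) ce_map_pi transport_cocyclesB.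
exact: (raddfB (\pi_(quotL' k))).
Qed.

HB.instance Definition _ k := GRing.isZmodMorphism.Build _ _ (@ce_map k)
  (@ce_map_is_zmod_morphism k).

End Morphism.

Lemma ce_cohomology_isomorphic (R : comNzRingType) (L C L' C' : lmodType R)
    (br : L -> L -> L) (act : L -> {linear C -> C})
    (br' : L' -> L' -> L') (act' : L' -> {linear C' -> C'})
    (phi : L' -> L) (phi' : L -> L') (psi : C -> C') (psi' : C' -> C) k :
  cancel phi phi' -> cancel phi' phi -> cancel psi psi' -> cancel psi' psi ->
  ce_morphism br act br' act' phi psi -> ce_morphism br' act' br act phi' psi' ->
  group_isomorphic (ce_cohomology br act k) (ce_cohomology br' act' k).
Proof.
move=> phiK phi'K psiK psi'K m m'.
exists (ce_map m (k := k)); exists (ce_map m' (k := k)).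
  elim/quotP => z _; rewrite /= (ce_map_pi m) (ce_map_pi m').
  congr (\pi_(Quotient.quot _) _); apply/val_inj/funext => X /=.
  by rewrite /transport psiK; congr (cocycle_val z); apply/funext => i /=.
elim/quotP => z _; rewrite /= (ce_map_pi m') (ce_map_pi m).
congr (\pi_(Quotient.quot _) _); apply/val_inj/funext => X /=.
by rewrite /transport psi'K; congr (cocycle_val z); apply/funext => i /=.
Qed.

End Functoriality.

(** * Fields tangent to the leaves *)

Section Leaves.
Variables (R : realType) (Q : dspace R) (f : Cinf Q).

Lemma connected_component_absorb (A B : set Q) p q : connected_component A p q ->
  B q -> B `<=` A -> connected B -> B `<=` connected_component A p.
Proof.
move=> /same_connected_component -> Bq BA cB; exact: connected_component_max.
Qed.

(** Except for rings, a leaf is a component of a level set or of the critical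
set, both of which contain A. For a ring, A must moreover avoid the critical
circles: these are components of the critical set, so one that meets A contains
A and in particular p, which is not on a circle. *)
Lemma leaf_absorb (L A : set Q) (p : Q) : partition_leaf f L -> L p -> A p ->
  connected A -> (forall q, A q -> f q = f p) ->
  (forall q, A q -> critical f q <-> critical f p) -> A `<=` L.
Proof.
move=> leafL Lp Ap cA Af Acrit.
have in_fiber F : fiber f F -> F p -> A `<=` F.
  move=> [z ->] Fp; apply: (connected_component_absorb Fp Ap _ cA) => q Aq /=.
  by rewrite (Af q Aq); exact: (connected_component_sub Fp).
case: leafL => [[[fibL _]|[fibL _ _]]|[[z cz LE] _]|[F [fibF _ _] [z F'z LE]]|[fibL _]].
- exact: in_fiber.
- exact: in_fiber.
- rewrite LE in Lp *.
  apply: (connected_component_absorb Lp Ap _ cA) => q Aq /=.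
  by apply/(Acrit q Aq); exact: (connected_component_sub Lp).
- rewrite LE in Lp *.
  apply: (connected_component_absorb Lp Ap _ cA) => q Aq /=.
  have [Fp nCp] := connected_component_sub Lp.
  split; first exact: (in_fiber _ fibF Fp).
  move=> [C hC Cq]; apply: nCp; exists C => //.
  have [[z' cz' CE] _] := hC.
  rewrite CE in Cq *; have absorb := connected_component_absorb Cq Aq _ cA.
  apply: (absorb _ p Ap) => q' Aq' /=.
  apply/(Acrit q' Aq'); apply/(Acrit q Aq).
  exact: (connected_component_sub Cq).
- exact: in_fiber.
Qed.

End Leaves.

Section TangentFields.
Variables (R : realType) (Q : dspace R) (n : nat) (v : vfield Q) (f : Cinf Q).
Hypotheses (mQ : manifold Q n) (bf : bott n f).
Implicit Type D : vfield Q.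

Lemma exists_first_order_curve D (p : Q) : D f = 0 ->
  exists d g, first_order_curve f D p d g.
Proof.
move=> Df0; have [crit|ncrit] := pselect (critical f p).
  have [[c [N sN]] nd] := bf crit.
  have [hc cp _] := sN.
  have [x xE] := chart_coordinates hc cp.
  exact: (critical_first_order_curve mQ Df0 hc cp xE sN crit (nd c N sN)).
have [_ _ /(_ p)[c hc cp] _] := mQ.
have [x xE] := chart_coordinates hc cp.
exact: (regular_first_order_curve mQ Df0 hc cp xE ncrit).
Qed.

(** The derivative along D of a function that vanishes on L near p is its
derivative along the curve of [exists_first_order_curve], which stays in L. *)
Lemma tangent_to_leaf D (L : set Q) : D f = 0 -> partition_leaf f L ->
  tangent_to L D.
Proof.
move=> Df0 leafL p Lp h hL.
have [d [g [d0 g0 gP gD]]] := exists_first_order_curve p Df0.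
pose J : set R := `[- (d / 2), d / 2]%classic.
have Jd t : J t -> `|t| < d.
  by rewrite /J /= in_itv /= ltr_norml => /andP[h1 h2]; apply/andP; split; lra.
have J0 : J 0 by rewrite /J /= in_itv /=; apply/andP; split; lra.
have gL : g @` J `<=` L.
  apply: (leaf_absorb leafL Lp).
  - by exists 0.
  - apply: connected_continuous_connected; first exact: segment_connected.
    apply: continuous_in_subspaceT => t; rewrite inE => /Jd td.
    by have [] := gP t td.
  - by move=> _ [t /Jd td <-]; have [] := gP t td.
  - by move=> _ [t /Jd td <-]; have [] := gP t td.
have d20 : 0 < d / 2 by rewrite divr_gt0.
have small := @pseudometric_normed_Zmodule.nbhs0_lt R R _ d20.
have n0 : `|0 : R| < d by rewrite normr0.
have [cg _ _] := gP 0 n0.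
have near0 : \forall t \near (0 : R), (h \o g) t = (cst 0 : R -> R) t.
  have H : \forall t \near (0 : R), L (g t) -> h (g t) = 0.
    by apply: (cg (fun q => L q -> h q = 0)); rewrite g0.
  near=> t; have td : `|t| < d / 2 by near: t; exact: small.
  have : L (g t) -> h (g t) = 0 by near: t; exact: H.
  apply; apply: gL; exists t => //.
  by move: td; rewrite ltr_norml /J /= in_itv /= => /andP[h1 h2]; apply/andP; split; lra.
by have [_ <-] := near_eq_is_derive near0 (gD h); rewrite derive_cst.
Unshelve. all: by end_near. Qed.

Lemma tangent_to_level D (L : set Q) p : tangent_to L D -> L p ->
  (forall q, L q -> f q = f p) -> D f p = 0.
Proof.
move=> tD Lp Lf; have tw := vfield_tangent_vector D p.
have : D (f - f p *: (1 : Cinf Q)) p = 0.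
  apply: tD Lp _ _; apply: filterE => q Lq.
  by rewrite CinfBE CinfZE mulr1 Lf // subrr.
by rewrite (tangent_vectorB tw) (tangent_vector_cst tw) subr0.
Qed.

Lemma liouville_torus_level (L : set Q) p q : liouville_torus f L -> L p -> L q ->
  f q = f p.
Proof.
have level (L' : set Q) : fiber f L' -> L' p -> L' q -> f q = f p.
  move=> [z ->] /connected_component_sub /= -> /connected_component_sub.
  by [].
by case=> [[]|[]] => [/level H _|/level H _ _]; exact: H.
Qed.

Hypothesis nonres : nonresonant v f.

Lemma tangent_to_tori_first_integral D :
  (forall L, liouville_torus f L -> tangent_to L D) -> D f = 0.
Proof.
move=> tD; apply/val_inj/funext => p; apply: contrapT => /eqP Dfp.
have cDf : continuous (D f : Q -> R) by exact: (Cinf_continuous mQ).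
have oU : open [set q : Q | D f q != 0].
  apply: (@open_comp _ _ (D f : Q -> R) [set t | t != 0]) => [q _|].
    exact: cDf.
  exact: open_neq.
have [|q [/= Dfq [L [hL _] Lq]]] := nonres _ oU; first by exists p.
move/eqP: Dfq; apply; apply: (tangent_to_level (tD L hL) Lq) => q' Lq'.
exact: liouville_torus_level hL Lq Lq'.
Qed.

(** Tangency to the tori already forces D f = 0, which in turn implies tangency
to all leaves, singular ones included. *)
Lemma tangent_allP D : D \in tangent_all (partition_leaf f) <->
  forall L, liouville_torus f L -> tangent_to L D.
Proof.
split=> [/asboolP H L hL|H]; first by apply: H; apply: Or41.
apply/asboolP => L; apply: tangent_to_leaf.
exact: tangent_to_tori_first_integral.
Qed.

End TangentFields.

(** * Transport by a diffeomorphism *)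

Section Transport.
Variable R : realType.

Definition diffeo_inv (X Y : dspace R) (g : diffeo X Y) : diffeo Y X :=
  Diffeo (@dinvK _ _ _ g) (@dfunK _ _ _ g)
    (@dinv_continuous _ _ _ g) (@dfun_continuous _ _ _ g)
    (@dinv_smooth _ _ _ g) (@dfun_smooth _ _ _ g).

Lemma pullbackK (X Y : dspace R) (g : diffeo X Y) :
  cancel (pullback g) (pullback (diffeo_inv g)).
Proof. by move=> h; apply/val_inj/funext => q /=; rewrite dinvK. Qed.

Lemma pullback_invK (X Y : dspace R) (g : diffeo X Y) :
  cancel (pullback (diffeo_inv g)) (pullback g).
Proof. by move=> h; apply/val_inj/funext => q /=; rewrite dfunK. Qed.

Lemma pullback_linear (X Y : dspace R) (g : diffeo X Y) : linear (pullback g).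
Proof. by move=> c f h; apply/val_inj/funext. Qed.

Lemma pullbackM (X Y : dspace R) (g : diffeo X Y) (f h : Cinf Y) :
  pullback g (f * h) = pullback g f * pullback g h.
Proof. exact/val_inj/funext. Qed.

Lemma pullback_field_subproof (X Y : dspace R) (g : diffeo X Y) (E : vfield Y) :
  (fun h => pullback g (E (pullback (diffeo_inv g) h))) \in @derivation R X.
Proof.
have [lE mE] := vfieldP E; apply/asboolP; split=> [c f h|f h].
  by rewrite pullback_linear lE pullback_linear.
rewrite pullbackM mE; apply/val_inj/funext => q /=.
by rewrite !fctE /= dfunK.
Qed.

Definition pullback_field (X Y : dspace R) (g : diffeo X Y) (E : vfield Y) :
  vfield X := MkVfield (pullback_field_subproof g E).

Lemma pullback_inv_inv (X Y : dspace R) (g : diffeo X Y) :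
  pullback (diffeo_inv (diffeo_inv g)) = pullback g.
Proof. by apply/funext => h; apply/val_inj. Qed.

Lemma pullback_fieldK (X Y : dspace R) (g : diffeo X Y) :
  cancel (pullback_field g) (pullback_field (diffeo_inv g)).
Proof.
move=> E; apply/val_inj/funext => h /=.
by rewrite pullback_inv_inv !pullbackK.
Qed.

Lemma pullback_field_invK (X Y : dspace R) (g : diffeo X Y) :
  cancel (pullback_field (diffeo_inv g)) (pullback_field g).
Proof.
move=> E; apply/val_inj/funext => h /=.
by rewrite pullback_inv_inv !pullback_invK.
Qed.

Lemma tangent_to_pullback (X Y : dspace R) (g : diffeo X Y) (E : vfield Y)
    (L : set X) : tangent_to (g @` L) E -> tangent_to L (pullback_field g E).
Proof.
move=> tE p Lp h hL /=; apply: (tE (g p)); first by exists p.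
have hgp : \forall q \near Defs.dinv g (g p), L q -> h q = 0 by rewrite dfunK.
have hg : \forall r \near g p, L (Defs.dinv g r) -> h (Defs.dinv g r) = 0.
  exact: (@dinv_continuous _ _ _ g (g p) _ hgp).
apply: filterS hg => r hr [q Lq rq] /=.
by apply: hr; rewrite -rq dfunK.
Qed.

Section Cohomology.
Variables (X Y : dspace R) (g : diffeo X Y).
Variables (PX : set (set X)) (PY : set (set Y)).
Hypothesis pull : forall E, E \in tangent_all PY ->
  pullback_field g E \in tangent_all PX.

Definition pullback_tfield (E : tfield PY) : tfield PX :=
  MkTfield (pull (valP E)).

Lemma pullback_ce_morphism :
  ce_morphism (@tbracket R X PX) (@tlie_derivative R X PX)
    (@tbracket R Y PY) (@tlie_derivative R Y PY)
    pullback_tfield (pullback (diffeo_inv g)).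
Proof.
split.
- move=> c E E'; apply/val_inj/val_inj/funext => h.
  exact/val_inj/funext.
- exact: pullback_linear.
- move=> E E'; apply/val_inj/val_inj/funext => h; apply/val_inj/funext => q /=.
  by rewrite !pullbackK.
- move=> E h; apply/val_inj/funext => q /=.
  by rewrite dinvK.
Qed.

End Cohomology.

Lemma HP_isomorphic (X Y : dspace R) (g : diffeo X Y) (PX : set (set X))
    (PY : set (set Y)) :
  (forall E, E \in tangent_all PY -> pullback_field g E \in tangent_all PX) ->
  (forall D, D \in tangent_all PX ->
    pullback_field (diffeo_inv g) D \in tangent_all PY) ->
  forall k, group_isomorphic (HP PX k) (HP PY k).
Proof.
move=> pull push k.
apply: (ce_cohomology_isomorphic k (phi := pullback_tfield pull)
  (phi' := pullback_tfield push) (psi := pullback (diffeo_inv g))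
  (psi' := pullback g)).
- by move=> E; apply/val_inj; exact: pullback_fieldK.
- by move=> D; apply/val_inj; exact: pullback_field_invK.
- exact: pullback_invK.
- exact: pullbackK.
- exact: pullback_ce_morphism.
- exact: (pullback_ce_morphism push).
Qed.

End Transport.

Theorem theorem3p4 (R : realType) (S1 S2 : bott_system R) :
  topologically_equivalent S1 S2 ->
  forall k : nat, group_isomorphic (HP_system S1 k) (HP_system S2 k).
Proof.
move=> [g [_ tori _ _]].
have tangentP (S : bott_system R) D :
    D \in tangent_all (partition_leaf (Defs.integral S)) <->
    forall L, liouville_torus (Defs.integral S) L -> tangent_to L D.
  apply: tangent_allP; first exact: (isoenergetic_closed S).1.
    exact: integral_bott.
  exact: system_nonresonant.
apply: (HP_isomorphic (g := g)) => [E /tangentP tE|D /tangentP tD].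
  apply/tangentP => L /tori hL; apply: tangent_to_pullback; exact: tE.
apply/tangentP => L hL; apply: tangent_to_pullback; apply: tD.
apply/tori; suff -> : g @` (diffeo_inv g @` L) = L by [].
rewrite image_comp (_ : _ \o _ = id) ?image_id //.
by apply/funext => q /=; rewrite dinvK.
Qed.
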